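(* Let $C$ be a curve in $2H$ with $T(C)=\{Z,Y,P\}$. Suppose $S$ is a surface in $\mathbb{P}^3$ containing $C$ and meeting $H$ properly, and let $Q=H\cap S$. Then the curve $D$ linked to $C$ by the complete intersection $2H\cap S$ has triple $T(D)=\{Z,Q-P,Q-Y\}$; in particular, $Z\subset Q-P$. Conversely, if $Q\subset H$ is a curve containing $P$ such that $Z\subset Q-P$, then $C$ is linked by the complete intersection of $2H$ with some surface $S$ to a curve $D$ with $T(D)=\{Z,Q-P,Q-Y\}$. In particular, $Z$ and $P-Y$ are invariant under liaison on $2H$.
   Context: $k$ is an algebraically closed field. A curve is a purely one-dimensional locally Cohen-Macaulay (i.e. without embedded points) closed subscheme of $\mathbb{P}^3=\mathbb{P}^3_k$. $H\subset\mathbb{P}^3$ is a plane with equation $h=0$, and $2H$ is the scheme defined by $h^2=0$. The triple $T(C)=\{Z,Y,P\}$ associated to a curve $C\subset 2H$ is defined as follows: one writes $\mathcal{I}_{C\cap H,H}=\mathcal{I}_{Z,H}(-P)$ with $P\subset H$ a curve (effective Cartier divisor) and $Z\subset H$ zero-dimensional (possibly empty); and $Y\subset H$ is the residual scheme to the intersection of $C$ with $H$, i.e. $\mathcal{I}_Y=(\mathcal{I}_C:\mathcal{I}_H)$ ($Y$ is empty iff $C\subset H$). One has $Z\subseteq Y\subseteq P$. Differences such as $Q-P$, $Q-Y$, $P-Y$ are differences of effective divisors in the plane $H$ (each is effective or zero here, and is identified with the corresponding closed subscheme of $H$). The curve $D$ linked to $C$ by a complete intersection $E=2H\cap S\supseteq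 C$ is the residual subscheme with $\mathcal{I}_D=(\mathcal{I}_E:\mathcal{I}_C)$; equivalently $\mathcal{I}_{D,2H}=\mathcal{H}om_{\mathcal{O}_{2H}}(\mathcal{I}_{C,2H},\mathcal{I}_{E,2H})$ inside $\mathcal{H}om_{\mathcal{O}_{2H}}(\mathcal{I}_{E,2H},\mathcal{I}_{E,2H})\cong\mathcal{O}_{2H}$. In the degenerate case $C=E$, $D$ is empty and its triple is taken to be empty. Liaison on $2H$ is the equivalence relation generated by linkage by such complete intersections $2H\cap S$. *)

(* Defs.v *)
From mathcomp Require Import all_boot all_order all_algebra.
From mathcomp Require Import boolp classical_sets.
From mathcomp Require Import mpoly.
From Stdlib Require Import Relations.
Set Implicit Arguments.
Unset Strict Implicit.
Unset Printing Implicit Defensive.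
Import GRing.Theory.
Local Open Scope classical_set_scope.
Local Open Scope ring_scope.

(* A closed subscheme X of Proj k[x_0, ..., x_(n-1)] is
   represented by its saturated homogeneous ideal I_X, and X = Y means
   I_X = I_Y.  Inclusions are reversed: X is contained in Y when I_Y is
   contained in I_X.  The empty scheme is the unit ideal setT. *)

Definition is_ideal (k : fieldType) (n : nat) (I : set {mpoly k[n]}) : Prop :=
  [/\ I 0, (forall f g, I f -> I g -> I (f + g))
    & (forall f g, I g -> I (f * g))].

Definition homogeneous_ideal (k : fieldType) (n : nat)
    (I : set {mpoly k[n]}) : Prop :=
  is_ideal I /\ forall f d, I f -> I (pihomog mdeg d f).

Definition prime_ideal (k : fieldType) (n : nat)
    (I : set {mpoly k[n]}) : Prop :=
  [/\ is_ideal I, ~ I 1 & forall f g, I (f * g) -> I f \/ I g].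

Definition principal (k : fieldType) (n : nat)
    (f : {mpoly k[n]}) : set {mpoly k[n]} :=
  [set g | exists a, g = a * f].

Definition ideal_sum (k : fieldType) (n : nat)
    (I J : set {mpoly k[n]}) : set {mpoly k[n]} :=
  [set f | exists a b, [/\ I a, J b & f = a + b]].

Definition ideal_prod (k : fieldType) (n : nat)
    (I J : set {mpoly k[n]}) : set {mpoly k[n]} :=
  [set f | exists s : seq ({mpoly k[n]} * {mpoly k[n]}),
     (forall x, x \in s -> I x.1 /\ J x.2) /\
     f = \sum_(x <- s) x.1 * x.2].

Definition ideal_colon (k : fieldType) (n : nat)
    (I J : set {mpoly k[n]}) : set {mpoly k[n]} :=
  [set f | forall g, J g -> I (f * g)].

Definition saturation (k : fieldType) (n : nat)
    (I : set {mpoly k[n]}) : set {mpoly k[n]} :=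
  [set f | forall i : 'I_n, exists m : nat, I ('X_i ^+ m * f)].

Definition closed_subscheme (k : fieldType) (n : nat)
    (X : set {mpoly k[n]}) : Prop :=
  homogeneous_ideal X /\ saturation X = X.

Definition subscheme (k : fieldType) (n : nat)
    (X Y : set {mpoly k[n]}) : Prop := Y `<=` X.

Definition empty_scheme (k : fieldType) (n : nat) : set {mpoly k[n]} := setT.
Arguments empty_scheme {k n}.

Definition scheme_cap (k : fieldType) (n : nat)
    (X Y : set {mpoly k[n]}) : set {mpoly k[n]} :=
  saturation (ideal_sum X Y).

(* The colon of two saturated ideals is already saturated. *)
Definition residual (k : fieldType) (n : nat)
    (E X : set {mpoly k[n]}) : set {mpoly k[n]} := ideal_colon E X.

(* A point of the scheme Proj k[x_0, ..., x_(n-1)]. *)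
Definition proj_point (k : fieldType) (n : nat)
    (p : set {mpoly k[n]}) : Prop :=
  [/\ homogeneous_ideal p, prime_ideal p & exists i : 'I_n, ~ p 'X_i].

Definition point_of (k : fieldType) (n : nat)
    (X p : set {mpoly k[n]}) : Prop := proj_point p /\ X `<=` p.

Definition generic_point (k : fieldType) (n : nat)
    (X p : set {mpoly k[n]}) : Prop :=
  point_of X p /\ forall q, point_of X q -> q `<=` p -> q = p.

Definition associated_point (k : fieldType) (n : nat)
    (X p : set {mpoly k[n]}) : Prop :=
  proj_point p /\ exists f, p = ideal_colon X (principal f).

(* A chain of points p_0, ..., p_d is the chain of their closures, which are
   irreducible closed subsets of X. *)
Definition dim_ge (k : fieldType) (n : nat)
    (X : set {mpoly k[n]}) (d : nat) : Prop :=
  exists p : nat -> set {mpoly k[n]},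
    (forall i, (i <= d)%N -> point_of X (p i)) /\
    (forall i, (i < d)%N -> p i `<` p i.+1).

Definition dim_eq (k : fieldType) (n : nat)
    (X : set {mpoly k[n]}) (d : nat) : Prop :=
  dim_ge X d /\ ~ dim_ge X d.+1.

(* The empty scheme is included. *)
Definition zero_dimensional (k : fieldType) (n : nat)
    (X : set {mpoly k[n]}) : Prop :=
  closed_subscheme X /\ ~ dim_ge X 1.

(* The closure of a point p, with its reduced structure, is the closed
   subscheme with ideal p. *)
Definition pure_dim (k : fieldType) (n : nat)
    (X : set {mpoly k[n]}) (d : nat) : Prop :=
  dim_eq X d /\ forall p, generic_point X p -> dim_eq p d.

Definition no_embedded_points (k : fieldType) (n : nat)
    (X : set {mpoly k[n]}) : Prop :=
  forall p, associated_point X p -> generic_point X p.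

Definition curve (k : fieldType) (n : nat) (X : set {mpoly k[n]}) : Prop :=
  [/\ closed_subscheme X, pure_dim X 1 & no_embedded_points X].

Definition curve_or_empty (k : fieldType) (n : nat)
    (X : set {mpoly k[n]}) : Prop :=
  curve X \/ X = empty_scheme.

(* ~ H f says that the form f does not vanish identically on H; the divisor is
   zero (the empty scheme) exactly when d = 0. *)
Definition effective_divisor (k : fieldType) (n : nat)
    (H P : set {mpoly k[n]}) : Prop :=
  exists (d : nat) (f : {mpoly k[n]}),
    [/\ f \is d.-homog, ~ H f & P = scheme_cap H (principal f)].

(* The subscheme of H with ideal sheaf I_{A,H} . I_{B,H} in O_H.  If B is an
   effective divisor this ideal sheaf is I_{A,H}(-B), and if A is one too the
   subscheme is the divisor A + B. *)
Definition add_divisor (k : fieldType) (n : nat)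
    (H A B : set {mpoly k[n]}) : set {mpoly k[n]} :=
  saturation (ideal_sum (ideal_prod A B) H).

(* R = Q - P as effective (possibly zero) divisors on H. *)
Definition divisor_difference (k : fieldType) (n : nat)
    (H Q P R : set {mpoly k[n]}) : Prop :=
  [/\ effective_divisor H Q, effective_divisor H P, effective_divisor H R
    & Q = add_divisor H P R].

Definition plane (k : fieldType) (h : {mpoly k[4]}) : set {mpoly k[4]} :=
  principal h.

Definition double_plane (k : fieldType) (h : {mpoly k[4]})
  : set {mpoly k[4]} := principal (h ^+ 2).

(* T(C) = {Z, Y, P} *)
Definition has_triple (k : fieldType) (h : {mpoly k[4]})
    (C Z Y P : set {mpoly k[4]}) : Prop :=
  [/\ zero_dimensional Z /\ subscheme Z (plane h),
      effective_divisor (plane h) P,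
      scheme_cap C (plane h) = add_divisor (plane h) Z P
    & Y = residual C (plane h)].

Definition surface (k : fieldType) (S : set {mpoly k[4]}) : Prop :=
  exists (d : nat) (s : {mpoly k[4]}),
    [/\ (0 < d)%N, s \is d.-homog, s != 0 & S = principal s].

Definition meets_properly (k : fieldType) (h : {mpoly k[4]})
    (S : set {mpoly k[4]}) : Prop :=
  dim_eq (scheme_cap (plane h) S) 1.

Definition linked_by (k : fieldType) (h : {mpoly k[4]})
    (S C D : set {mpoly k[4]}) : Prop :=
  [/\ surface S, subscheme C S, meets_properly h S
    & D = residual (scheme_cap (double_plane h) S) C].

(* The empty scheme is linked to 2H \cap S itself. *)
Definition directly_linked (k : fieldType) (h : {mpoly k[4]})
    (C D : set {mpoly k[4]}) : Prop :=
  [/\ curve_or_empty C /\ subscheme C (double_plane h),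
      curve_or_empty D /\ subscheme D (double_plane h)
    & exists S, linked_by h S C D].

Definition liaison (k : fieldType) (h : {mpoly k[4]})
  : set {mpoly k[4]} -> set {mpoly k[4]} -> Prop :=
  clos_refl_sym_trans _ (@directly_linked k h).

(* Main.v *)
(* Modulo h^2, an ideal of R = k[x_0, ..., x_3] containing h^2 is a set of pairs
   (a, b), standing for a + h b, with entries in the coordinate ring A of H.  As
   A is factorial, the ideal of a curve C contains (0, b) exactly when g | b, and
   its first components form f Z, where f = g e and the ideal Z has no common
   divisor; so T(C) = {Z, (g), (f)} and P - Y = (e).  A surface S through C has
   equation (q, t) modulo h^2, with q = z0 f and z0 in Z.  If D is the residual of
   C in 2H \cap S, then (0, d) lies in D exactly when z0 | d, and
   (v z0 e, d) lies in D exactly when (v f, y) lies in C for the y with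
   z0 y = v t - g d; hence T(D) = {Z, (z0), (z0 e)}.  The second equivalence uses
   that C has no associated closed points, which enters as a cancellation property
   with respect to coprime pairs of A.  The converse statement uses that f Z is
   saturated, because the first cohomology of the ideal of a plane curve vanishes,
   so that every q in f Z lifts to a surface through C. *)
Require Import Defs.
From HB Require Import structures.
From mathcomp Require Import all_boot all_order all_algebra.
From mathcomp Require Import boolp classical_sets.
From mathcomp Require Import mpoly ring.

Set Implicit Arguments.
Unset Strict Implicit.
Unset Printing Implicit Defensive.
Import GRing.Theory.
Local Open Scope classical_set_scope.
Local Open Scope ring_scope.

(** * GCD domains *)

Section Divisibility.
Variable R : idomainType.
Implicit Types a b c x y q : R.

(** The section [lft] of the reduction R -> A identifies R/(h^2) with the dual numbers A + hA, so no
    quotient ring has to be formed. Codimension two in A is expressed by pairs: [coprime_elts a b]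
    says that no nonzero class of any A/(q) is killed by both a and b, which is grade at least two
    in terms of divisibility. Absence of associated closed points and zero-dimensionality both
    become statements about such pairs, and the linkage computation itself is then pure
    divisibility. Points of Proj serve to translate the geometric definitions into this language and
    back. The obstacle in that translation is to find a closed point under a homogeneous ideal that
    contains a coprime pair. This is done by elimination: a nonzero binary form is produced and
    split into linear factors, which uses that k is algebraically closed. A second use of k is that
    it is infinite: a general combination of two elements of an ideal has no accidental common
    factor with a third. *)

Definition divides a b := exists c, b = c * a.

(* In a GCD domain this says that a and b have no common factor. *)
Definition coprime_elts a b :=
  forall q x, divides q (a * x) -> divides q (b * x) -> divides q x.

Lemma divides_refl a : divides a a.
Proof. by exists 1; rewrite mul1r. Qed.

Lemma divides0 a : divides a 0.
Proof. by exists 0; rewrite mul0r. Qed.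

Lemma divides_trans b a c : divides a b -> divides b c -> divides a c.
Proof. by move=> [x ->] [y ->]; exists (y * x); rewrite mulrA. Qed.

Lemma divides_mull a b c : divides a b -> divides a (c * b).
Proof. by move=> [x ->]; exists (c * x); rewrite mulrA. Qed.

Lemma divides_mulr a b c : divides a b -> divides a (b * c).
Proof. by rewrite mulrC; apply: divides_mull. Qed.

Lemma divides_mul a b c d : divides a b -> divides c d -> divides (a * c) (b * d).
Proof. by move=> [x ->] [y ->]; exists (x * y); ring. Qed.

Lemma dividesD a b c : divides a b -> divides a c -> divides a (b + c).
Proof. by move=> [x ->] [y ->]; exists (x + y); rewrite mulrDl. Qed.

Lemma dividesN a b : divides a b -> divides a (- b).
Proof. by move=> [x ->]; exists (- x); rewrite mulNr. Qed.

Lemma dividesB a b c : divides a b -> divides a c -> divides a (b - c).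
Proof. by move=> ab ac; apply/dividesD/dividesN. Qed.

Lemma divides1 a : divides 1 a.
Proof. by exists a; rewrite mulr1. Qed.

Lemma unit_divides a b : divides a 1 -> divides a b.
Proof. by move=> a1; rewrite -[b]mulr1; apply: divides_mull. Qed.

Lemma divides_cancel a b c : c != 0 -> divides (a * c) (b * c) -> divides a b.
Proof. by move=> c0 [x]; rewrite mulrA => /(mulIf c0) ->; exists x. Qed.

Lemma divides_neq0 a b : divides a b -> b != 0 -> a != 0.
Proof. by move=> [x ->]; apply: contraNneq => ->; rewrite mulr0. Qed.

Lemma coprime_eltsC a b : coprime_elts a b -> coprime_elts b a.
Proof. by move=> ab q x qb qa; apply: ab. Qed.

Lemma coprime_unit a b : divides a 1 -> coprime_elts a b.
Proof.
move=> [c Ec] q x qa _; have -> : x = c * (a * x) by rewrite mulrA -Ec mul1r.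
exact: divides_mull.
Qed.

Lemma coprime_common a b q :
  coprime_elts a b -> divides q a -> divides q b -> divides q 1.
Proof. by move=> ab qa qb; apply: ab; rewrite mulr1. Qed.

Lemma coprime_gauss a b x : coprime_elts a b -> divides a (b * x) -> divides a x.
Proof. by move=> ab; apply: ab; apply/divides_mulr/divides_refl. Qed.

Lemma coprime_mul a b c :
  coprime_elts a b -> coprime_elts a c -> coprime_elts a (b * c).
Proof.
move=> ab ac q x qa qbc; apply: ac => //; apply: ab; last by rewrite mulrA.
by rewrite mulrCA; apply: divides_mull.
Qed.

(** Coprimality of the cofactors already makes g a greatest common divisor: what divides a' g and b'
    g divides g. *)
Definition gcd_domain :=
  forall a b, exists g a' b', [/\ a = a' * g, b = b' * g & coprime_elts a' b'].

Hypothesis gcdR : gcd_domain.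

Lemma no_common_factor_coprime a b :
  (forall q, divides q a -> divides q b -> divides q 1) -> coprime_elts a b.
Proof.
move=> H; have [g [a' [b' [Ea Eb c]]]] := gcdR a b.
have [u Eu] : divides g 1 by apply: H; [exists a' | exists b'].
move=> q x; rewrite Ea Eb -!mulrA => qa qb.
have -> : x = u * (g * x) by rewrite mulrA -Eu mul1r.
exact/divides_mull/c.
Qed.

Lemma irreducible_is_prime p x y :
  (forall a b, p = a * b -> divides a 1 \/ divides b 1) ->
  divides p (x * y) -> divides p x \/ divides p y.
Proof.
move=> irr pxy; have [px | npx] := pselect (divides p x); first by left.
right; apply: (coprime_gauss _ pxy).
apply: no_common_factor_coprime => q [s Es] qx.
case: (irr _ _ Es) => [[u Eu] |//]; case: npx; apply: divides_trans qx.
by exists u; rewrite Es mulrA -Eu mul1r.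
Qed.

End Divisibility.

(** * Gauss's lemma and greatest common divisors of polynomials *)

Section GaussLemma.
Variable R : idomainType.
Hypothesis gcdR : gcd_domain R.
Implicit Types (c d e : R) (p q : {poly R}).

Definition primitive_poly p := forall c, divides c%:P p -> divides c 1.

Lemma divides_polyC c p : divides c%:P p <-> forall i, divides c p`_i.
Proof.
split=> [[q ->] i | cp].
  by rewrite coefMC; apply/divides_mull/divides_refl.
have [f fP] := choice cp.
exists (\poly_(i < size p) f i); apply/polyP => i.
rewrite coefMC coef_poly; case: ltnP => [_ | le_i]; first exact: fP.
by rewrite mul0r nth_default.
Qed.

Lemma seq_gcd (s : seq R) : exists g, (forall x, x \in s -> divides g x) /\
  forall c, (forall x, x \in s -> divides c x) -> divides c g.
Proof.
elim: s => [|x s [g [gs sg]]].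
  by exists 0; split=> // c _; apply: divides0.
have [g' [x' [y' [Ex Eg cop]]]] := gcdR x g.
exists g'; split=> [y | c cs].
  rewrite inE => /orP[/eqP-> | ys]; first by exists x'.
  by apply: divides_trans (gs _ ys); exists y'.
apply: cop; first by rewrite -Ex; apply: cs; rewrite mem_head.
by rewrite -Eg; apply: sg => y ys; apply: cs; rewrite inE ys orbT.
Qed.

Lemma content_exists p : p != 0 -> exists c q, p = c%:P * q /\ primitive_poly q.
Proof.
move=> p0; have [g [gp pg]] := seq_gcd p.
have : divides g%:P p.
  apply/divides_polyC => i; have [lt_i | ge_i] := ltnP i (size p).
    by apply/gp/mem_nth.
  by rewrite nth_default //; apply: divides0.
move=> [q Eq]; exists g, q; split=> [|c [r Er]]; first by rewrite mulrC.
have g0 : g != 0 by apply: contraNneq p0 => g0; rewrite Eq g0 mulr0.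
apply: (divides_cancel g0); rewrite mul1r; apply: pg => x /(nthP 0)[i _ <-].
by rewrite Eq Er -mulrA -polyCM coefMC; apply/divides_mull/divides_refl.
Qed.

Lemma primitive_neq0 p : primitive_poly p -> p != 0.
Proof.
move=> pp; apply/eqP=> p0; have [|c /eqP] := pp 0; first by rewrite p0; apply: divides0.
by rewrite mulr0 oner_eq0.
Qed.

Lemma divides_polyCC c d : divides c d -> divides c%:P d%:P.
Proof. by move=> [x ->]; exists x%:P; rewrite polyCM. Qed.

(** After removal of gcd(d, e), the cofactor of d is coprime to that of e, so it divides every
    coefficient of p and is a unit. *)
Lemma primitive_divides_scaled d e p :
  primitive_poly p -> divides d%:P (e%:P * p) -> divides d e.
Proof.
move=> pp dep; have [g [d' [e' [Ed Ee cop]]]] := gcdR d e.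
have [g0 | g0] := eqVneq g 0; first by rewrite Ed Ee g0 !mulr0; apply: divides0.
have d'p : divides d'%:P p.
  apply/divides_polyC => i; apply: (coprime_gauss cop).
  apply: (divides_cancel g0); rewrite -Ed mulrAC -Ee -coefCM.
  by move/divides_polyC: dep; apply.
have [u Eu] := pp _ d'p.
by exists (e' * u); rewrite Ee Ed mulrA -[e' * u * d']mulrA -Eu mulr1.
Qed.

(* A common divisor of p * q and of the leading coefficient of p divides the
   product of q with p minus its leading term, and then p itself by induction. *)
Lemma gauss_lemma p q :
  primitive_poly p -> primitive_poly q -> primitive_poly (p * q).
Proof.
have [n] := ubnP (size p + size q); elim: n => // n IHn in p q *.
move=> le_n pp pq c cpq.
have step (p1 q1 : {poly R}) d : (size p1 + size q1 < n.+1)%N ->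
    primitive_poly p1 -> primitive_poly q1 -> divides d%:P (p1 * q1) ->
    divides d (lead_coef p1) -> divides d 1.
  move=> le1 pp1 pq1 dpq [a Ea].
  pose p2 := p1 - (lead_coef p1)%:P * 'X^((size p1).-1).
  have da : divides d%:P (lead_coef p1)%:P.
    by rewrite Ea polyCM; apply/divides_mull/divides_refl.
  have dp2 : divides d%:P (p2 * q1).
    by rewrite mulrBl; apply: dividesB => //; apply/divides_mulr/divides_mulr.
  apply: (pp1); have -> : p1 = p2 + (lead_coef p1)%:P * 'X^((size p1).-1) by rewrite subrK.
  apply: dividesD; last exact: divides_mulr.
  have [-> | p20] := eqVneq p2 0; first exact: divides0.
  have [e [r [Er pr]]] := content_exists p20.
  rewrite Er; apply/divides_mulr/divides_polyCC.
  apply: (@primitive_divides_scaled _ _ (r * q1)); last by rewrite mulrA -Er.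
  have sr : size r = size p2.
    have e0 : e != 0 by apply: contraNneq p20 => e0; rewrite Er e0 mul0r.
    by rewrite Er mul_polyC size_scale.
  apply: IHn => //; apply: leq_trans (le1 : (_ <= n)%N); rewrite ltn_add2r sr.
  have sp1 : (0 < size p1)%N by rewrite size_poly_gt0; exact: primitive_neq0 pp1.
  rewrite -[X in (_ < X)%N](prednK sp1) ltnS.
  apply/leq_sizeP => j; rewrite leq_eqVlt coefB coefCM coefXn => /orP[/eqP<-|lt_j].
    by rewrite eqxx mulr1 lead_coefE subrr.
  by rewrite gtn_eqF // mulr0 subr0 nth_default // -(prednK sp1).
have copl (p1 q1 : {poly R}) : (size p1 + size q1 < n.+1)%N ->
    primitive_poly p1 -> primitive_poly q1 -> divides c%:P (p1 * q1) ->
    coprime_elts c (lead_coef p1).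
  move=> le1 pp1 pq1 cpq1; apply: (no_common_factor_coprime gcdR) => d dc dl.
  by apply: (step p1 q1 d le1 pp1 pq1 _ dl); apply: divides_trans cpq1; apply: divides_polyCC.
have c1 : coprime_elts c (lead_coef p) by apply: copl pq _.
have c2 : coprime_elts c (lead_coef q).
  by apply: (copl q p) => //; [rewrite addnC | rewrite mulrC].
have cc := coprime_mul c1 c2; rewrite -lead_coefM in cc.
apply: (coprime_common cc (divides_refl _)).
by move/divides_polyC: cpq; rewrite lead_coefE; apply.
Qed.

Lemma divides_primitive_cancel c p q :
  primitive_poly p -> divides c%:P (p * q) -> divides c%:P q.
Proof.
move=> pp cpq; have [-> | q0] := eqVneq q 0; first exact: divides0.
have [e [r [Er pr]]] := content_exists q0.
rewrite Er; apply/divides_mulr/divides_polyCC.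
apply: (primitive_divides_scaled (gauss_lemma pp pr)).
by rewrite mulrCA -Er.
Qed.

Lemma primitive_divides_cancel c p q : c != 0 ->
  primitive_poly p -> divides p (c%:P * q) -> divides p q.
Proof.
move=> c0 pp [r Er]; have [|s Es] := @divides_primitive_cancel c p r pp.
  by rewrite mulrC -Er; apply/divides_mulr/divides_refl.
exists s; apply: (@mulfI _ c%:P); first by rewrite polyC_eq0.
by rewrite Er Es mulrAC mulrC.
Qed.

(** A q dividing c x and p x splits into a primitive part, which divides x because the constant c
    cancels, and a content, which divides the remaining factor because p cancels. *)
Lemma coprime_polyC_primitive c p : primitive_poly p -> c != 0 -> coprime_elts c%:P p.
Proof.
move=> pp c0 q x qcx qpx; have [x0 | x0] := eqVneq x 0; first by rewrite x0; apply: divides0.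
have q0 : q != 0 by apply: divides_neq0 qcx _; rewrite mulf_neq0 ?polyC_eq0.
have [e [r [Er pr]]] := content_exists q0.
have [|y Ey] := @primitive_divides_cancel c r x c0 pr.
  by apply: divides_trans qcx; rewrite Er; apply/divides_mull/divides_refl.
rewrite Ey Er; apply: divides_mul (divides_refl _).
have r0 := primitive_neq0 pr.
apply: (divides_primitive_cancel pp).
by apply: (divides_cancel r0); rewrite -mulrA -Ey -Er.
Qed.

(** [gcdp] is a gcd over the fraction field, hence only up to constants. By Gauss's lemma its
    primitive part m divides p and q over R itself; the Bezout relation survives with the cleared
    denominators collected in c. *)
Lemma bezout_primitive p q : primitive_poly p -> primitive_poly q ->
  exists p1 q1 m u v c, [/\ p = p1 * m, q = q1 * m, primitive_poly m, c != 0
    & u * p1 + v * q1 = c%:P].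
Proof.
move=> pp pq; have [p0 q0] := (primitive_neq0 pp, primitive_neq0 pq).
have m0 : gcdp p q != 0 by rewrite gcdp_eq0 negb_and p0.
have [e [m [Em pm]]] := content_exists m0.
have e0 : e != 0 by apply: contraNneq m0 => e0; rewrite Em e0 mul0r.
have dm r : gcdp p q %| r -> divides m r.
  move/Pdiv.Idomain.dvdpP => [[c s] /= c0 Es].
  apply: (primitive_divides_cancel c0 pm); exists (s * e%:P).
  by rewrite mul_polyC Es Em mulrA.
have [p1 Ep] := dm _ (dvdp_gcdl p q); have [q1 Eq] := dm _ (dvdp_gcdr p q).
have [[u v] /= ] := Bezoutp p q.
move/eqpP => [[a b] /= /andP[a0 b0]]; rewrite Em => Euv.
exists p1, q1, m, (a *: u), (a *: v), (b * e).
split=> //; first by rewrite mulf_neq0.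
apply: (mulIf (primitive_neq0 pm)).
by rewrite mulrDl -!mulrA -Ep -Eq -!scalerAl -scalerDr Euv polyCM -mul_polyC mulrA.
Qed.

Lemma bezout_coprime p q : primitive_poly p -> primitive_poly q ->
  (exists u v c, c != 0 /\ u * p + v * q = c%:P) -> coprime_elts p q.
Proof.
move=> pp pq [u [v [c [c0 Ec]]]] f x fp fq.
have [-> | x0] := eqVneq x 0; first exact: divides0.
apply: (coprime_polyC_primitive pp c0); last exact: fp.
by rewrite -Ec mulrDl -!mulrA; apply: dividesD; apply: divides_mull.
Qed.

(** The gcd is the gcd of the contents times that of the primitive parts. Coprimality of the
    cofactors splits into four cases: two constants, a constant and a primitive polynomial (twice),
    and two primitive polynomials with a Bezout relation. *)
Theorem gcd_domain_poly : gcd_domain {poly R}.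
Proof.
move=> p q; have [-> | p0] := eqVneq p 0.
  exists q, 0, 1; split; rewrite ?mul0r ?mul1r //.
  exact/coprime_eltsC/coprime_unit/divides_refl.
have [-> | q0] := eqVneq q 0.
  exists p, 1, 0; split; rewrite ?mul0r ?mul1r //.
  exact/coprime_unit/divides_refl.
have [c [p1 [Ep pp1]]] := content_exists p0.
have [d [q1 [Eq pq1]]] := content_exists q0.
have [c0 d0] : c != 0 /\ d != 0.
  by split; [apply: contraNneq p0 | apply: contraNneq q0] => z; rewrite ?Ep ?Eq z mul0r.
have [p2 [q2 [m [u [v [b [Ep1 Eq1 pm b0 Eb]]]]]]] := bezout_primitive pp1 pq1.
have [g [c' [d' [Ec Ed cop]]]] := gcdR c d.
have [c'0 d'0] : c' != 0 /\ d' != 0.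
  by split; [apply: contraNneq c0 | apply: contraNneq d0] => z; rewrite ?Ec ?Ed z mul0r.
have pp2 : primitive_poly p2.
  by move=> x xp2; apply: pp1; rewrite Ep1; apply: divides_mulr.
have pq2 : primitive_poly q2.
  by move=> x xq2; apply: pq1; rewrite Eq1; apply: divides_mulr.
exists (g%:P * m), (c'%:P * p2), (d'%:P * q2); split.
- by rewrite Ep Ec Ep1 polyCM; ring.
- by rewrite Eq Ed Eq1 polyCM; ring.
have copC : coprime_elts c'%:P d'%:P.
  move=> f x fc fd; have [x0 | x0] := eqVneq x 0; first by rewrite x0; apply: divides0.
  have f0 : f != 0 by apply: divides_neq0 fc _; rewrite mulf_neq0 ?polyC_eq0.
  have [e [r [Er pr]]] := content_exists f0.
  have [|y Ey] := @primitive_divides_cancel c' r x c'0 pr.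
    by apply: divides_trans fc; rewrite Er; apply/divides_mull/divides_refl.
  rewrite Ey Er; apply: divides_mul (divides_refl _); apply/divides_polyC => i.
  have r0 := primitive_neq0 pr.
  by apply: cop; rewrite -coefCM; apply: (divides_polyC _ _).1;
    apply: (divides_cancel r0); rewrite -mulrA -Ey -Er.
apply: coprime_mul; apply: coprime_eltsC; apply: coprime_mul.
- exact: coprime_eltsC.
- exact: coprime_polyC_primitive.
- exact/coprime_eltsC/coprime_polyC_primitive.
by apply: coprime_eltsC; apply: bezout_coprime => //; exists u, v, b.
Qed.

(** The constant c takes the place of the resultant; the common part m of the primitive parts is a
    unit by coprimality. *)
Lemma coprime_elimination p q : p != 0 -> q != 0 -> coprime_elts p q ->
  exists u v c, c != 0 /\ u * p + v * q = c%:P.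
Proof.
move=> p0 q0 cop; have [c [p1 [Ep pp1]]] := content_exists p0.
have [d [q1 [Eq pq1]]] := content_exists q0.
have [c0 d0] : c != 0 /\ d != 0.
  by split; [apply: contraNneq p0 | apply: contraNneq q0] => z; rewrite ?Ep ?Eq z mul0r.
have [p2 [q2 [m [u [v [b [Ep1 Eq1 pm b0 Eb]]]]]]] := bezout_primitive pp1 pq1.
have [w Ew] : divides m 1.
  by apply: (coprime_common cop); rewrite ?Ep ?Eq ?Ep1 ?Eq1;
    apply/divides_mull/divides_mull/divides_refl.
exists (d%:P * u * w), (c%:P * v * w), (c * d * b); split; first by rewrite !mulf_neq0.
rewrite Ep Eq Ep1 Eq1 !polyCM -Eb.
transitivity (c%:P * d%:P * (u * p2 + v * q2) * (w * m)); first by ring.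
by rewrite -Ew mulr1.
Qed.

End GaussLemma.

(** * Graded polynomial rings *)

Section GradingMorphism.
Variables (k : fieldType) (n : nat).
Implicit Types p q : {mpoly k[n]}.

(* The substitution x_i |-> t x_i, whose coefficient at t^d is the component
   of degree d. *)
Definition grading : {mpoly k[n]} -> {poly {mpoly k[n]}} :=
  mmap (polyC \o @mpolyC n k) (fun i => 'X_i *: 'X).

HB.instance Definition _ := GRing.RMorphism.on grading.

Lemma coef_grading p d : (grading p)`_d = pihomog mdeg d p.
Proof.
rewrite /grading /mmap coef_sum pihomogE [RHS]big_mkcond /=; apply: eq_bigr => m _.
rewrite /mmap1; have -> : \prod_(i < n) ('X_i *: 'X : {poly {mpoly k[n]}}) ^+ m i
    = 'X_[m] *: 'X^(mdeg m).
  rewrite mpolyXE_id mdegE -prodrXr -scaler_prod; apply: eq_bigr => i _.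
  by rewrite exprZn.
rewrite coefCM coefZ coefXn eq_sym; case: eqP => _; last by rewrite !mulr0.
by rewrite mulr1 mul_mpolyC.
Qed.

Lemma grading_homog p d : p \is d.-homog -> grading p = p *: 'X^d.
Proof.
move=> hp; apply/polyP => i; rewrite coef_grading coefZ coefXn.
have [->|ne] := eqVneq i d; first by rewrite mulr1 pihomog_dE.
by rewrite mulr0 (pihomog_ne0 _ hp) // eq_sym.
Qed.

Lemma homog_grading p q d : grading p = q *: 'X^d -> p \is d.-homog.
Proof.
move=> E; have pE i : pihomog mdeg i p = if i == d then q else 0.
  by rewrite -coef_grading E coefZ coefXn; case: eqP; rewrite ?mulr1 ?mulr0.
rewrite (pihomog_partitionE (leqnn (msize p))); apply: rpred_sum => i _.
by rewrite pE; case: eqP => [e|_]; [have := pE d; rewrite eqxx => <-; apply: pihomogP | apply: rpred0].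
Qed.

Lemma pihomogMr p q d e : q \is e.-homog ->
  pihomog mdeg (d + e) (p * q) = pihomog mdeg d p * q.
Proof.
move=> hq; rewrite -!coef_grading rmorphM /= (grading_homog hq).
by rewrite -scalerAr coefZ coefMXn addnK ltnNge leq_addl mulrC.
Qed.

Lemma pihomogMr_lt p q d e : q \is e.-homog -> (d < e)%N ->
  pihomog mdeg d (p * q) = 0.
Proof.
move=> hq lt; rewrite -coef_grading rmorphM /= (grading_homog hq).
by rewrite -scalerAr coefZ coefMXn lt mulr0.
Qed.

(** Under [grading] a form becomes a monomial in t. Taking the largest powers of t out of both
    factors leaves P and Q with nonzero constant terms; their product is constant, so P and Q are
    constant too. *)
Lemma homog_factor p q d : p * q != 0 -> p * q \is d.-homog ->
  exists e, p \is e.-homog.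
Proof.
move=> pq0 /grading_homog; rewrite rmorphM /= => E.
have gr0 r : r != 0 -> grading r != 0.
  apply: contra_neq => gr; rewrite (pihomog_partitionE (leqnn (msize r))).
  by rewrite big1 // => i _; rewrite -coef_grading gr coef0.
move: (pq0); rewrite mulf_eq0 negb_or => /andP[/gr0 p0 /gr0 q0].
have [a [P Pr EP]] := multiplicity_XsubC (grading p) 0.
have [b [Q Qr EQ]] := multiplicity_XsubC (grading q) 0.
rewrite p0 /= in Pr; rewrite q0 /= in Qr.
move: EP EQ; rewrite subr0 => EP EQ.
have PQ0 : (P * Q)`_0 != 0.
  by rewrite coef0M mulf_neq0 //; [move: Pr | move: Qr]; rewrite /root horner_coef0.
have E2 : P * Q * 'X^(a + b) = (p * q) *: 'X^d.
  by rewrite -E EP EQ exprD; ring.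
have abd : (a + b = d)%N.
  apply/eqP; move: (congr1 (fun r : {poly _} => r`_(a + b)) E2) => /=.
  rewrite coefMXn ltnn subnn coefZ coefXn; case: eqP => // _ /eqP.
  by rewrite mulr0 (negbTE PQ0).
have : P * Q = (p * q)%:P.
  apply: (@mulIf _ 'X^(a + b)); first by rewrite monic_neq0 ?monicXn.
  by rewrite E2 abd mul_polyC.
move=> EPQ; have P0 : P != 0 by apply: contraNneq PQ0 => ->; rewrite mul0r coef0.
have Q0 : Q != 0 by apply: contraNneq PQ0 => ->; rewrite mulr0 coef0.
have : size (P * Q) = 1 by rewrite EPQ size_polyC pq0.
rewrite size_mul // => s1.
have sP : (size P <= 1)%N.
  move: P0 Q0 s1; rewrite -!size_poly_gt0; case: (size P) => // s; case: (size Q) => // t.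
  by rewrite addnS /= => _ _ /eqP; rewrite addSn eqSS addn_eq0 => /andP[/eqP->].
exists a; apply: (@homog_grading _ P`_0).
by rewrite EP {1}(size1_polyC sP) mul_polyC.
Qed.

End GradingMorphism.

(** * Factoriality of polynomial rings and elimination of a variable *)

Section FactorialMpoly.
Variable k : fieldType.

Definition munpack n (p : {poly {mpoly k[n]}}) : {mpoly k[n.+1]} :=
  (map_poly (@mwiden n k) p).['X_ord_max].

HB.instance Definition _ n := GRing.RMorphism.copy (@munpack n)
  (horner_eval ('X_ord_max : {mpoly k[n.+1]}) \o map_poly (@mwiden n k)).

Lemma muni_mwiden n (c : {mpoly k[n]}) : muni (mwiden c) = c%:P.
Proof.
elim/mpolyind: c => [|c m p mp c0 IH]; first by rewrite mwiden0 muni0.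
rewrite mwidenD muniD IH polyCD; congr (_ + _).
rewrite mwidenZ muniZ mwidenX muniE msuppX big_seq1 mcoeffX eqxx scale1r.
rewrite mnmwiden_ordmax expr0 -!mul_polyC mulr1 -polyCM mul_mpolyC.
by congr (_ *: 'X_[_])%:P; apply/mnmP => i; rewrite mnmE mnmwiden_widen.
Qed.

Lemma muni_ordmax n : muni ('X_ord_max : {mpoly k[n.+1]}) = 'X.
Proof.
rewrite muniE msuppX big_seq1 mcoeffX eqxx scale1r mnm1E eqxx.
have -> : [multinom (U_(ord_max) (widen_ord (leqnSn n) i))%MM | i < n] = 0%MM.
  by apply/mnmP => i; rewrite mnmE mnm1E mnm0E -val_eqE /= gtn_eqF.
by rewrite mpolyX0 scale1r.
Qed.

Lemma muniK n : cancel (@muni n k) (@munpack n).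
Proof.
move=> p; rewrite muniE raddf_sum [RHS]mpolyE; apply: eq_bigr => m _ /=.
rewrite -[_ *: 'X^_]mul_polyC rmorphM /= /munpack map_polyXn hornerXn.
rewrite map_polyC hornerC /= mwidenZ mwidenX -scalerAl mpolyXn -mpolyXD.
congr (_ *: 'X_[_]); apply/mnmP => i; rewrite mnmDE mulmnE mnm1E.
have [<-|ne] := eqVneq ord_max i; first by rewrite mnmwiden_ordmax mul1n.
have lt : (i < n)%N by move: (ltn_ord i); rewrite ltnS leq_eqVlt => /orP[/eqP e|//]; case/eqP: ne; apply/val_inj.
have -> : i = widen_ord (leqnSn n) (Ordinal lt) by apply/val_inj.
by rewrite mnmwiden_widen mnmE mul0n addn0.
Qed.

Lemma munpackK n : cancel (@munpack n) (@muni n k).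
Proof.
elim/poly_ind => [|p c IH]; first by rewrite raddf0 muni0.
rewrite rmorphD rmorphM /= {2 3}/munpack map_polyX hornerX map_polyC hornerC.
by rewrite muniD muniM IH muni_ordmax muni_mwiden.
Qed.

Theorem gcd_domain_mpoly n : gcd_domain {mpoly k[n]}.
Proof.
elim: n => [|n IHn] p q.
  have [-> | p0] := eqVneq p 0.
    exists q, 0, 1; split; rewrite ?mul0r ?mul1r //.
    exact/coprime_eltsC/coprime_unit/divides_refl.
  have pu : (p@_0)^-1%:MP * p = 1.
    rewrite {2}[p]nvar0_mpolyC -mpolyCM mulVf ?mpolyC1 //.
    by apply: contraNneq p0 => e; rewrite [p]nvar0_mpolyC e.
  exists p, 1, (q * (p@_0)^-1%:MP); split; rewrite ?mul1r -?mulrA ?pu ?mulr1 //.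
  exact/coprime_unit/divides_refl.
have [g [p' [q' [Ep Eq cop]]]] := gcd_domain_poly IHn (muni p) (muni q).
exists (munpack g), (munpack p'), (munpack q'); split.
- by rewrite -rmorphM /= -Ep muniK.
- by rewrite -rmorphM /= -Eq muniK.
move=> d x [a Ea] [b Eb]; have [| |c Ec] := cop (muni d) (muni x).
- by exists (muni a); rewrite -muniM -Ea muniM munpackK.
- by exists (muni b); rewrite -muniM -Eb muniM munpackK.
by exists (munpack c); rewrite -(muniK x) Ec rmorphM /= muniK.
Qed.

(** Geometrically, the common zeros of a coprime pair project into a hypersurface c = 0 in the first
    n variables. *)
Lemma elimination n (a b : {mpoly k[n.+1]}) : a != 0 -> b != 0 -> coprime_elts a b ->
  exists u v c, c != 0 /\ u * a + v * b = mwiden c.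
Proof.
move=> a0 b0 cop; have inj0 (x : {mpoly k[n.+1]}) : x != 0 -> muni x != 0.
  by apply: contra_neq => e; rewrite -(muniK x) e raddf0.
have cop' : coprime_elts (muni a) (muni b).
  move=> d x [y Ey] [z Ez]; have [| |c Ec] := cop (munpack d) (munpack x).
  - by exists (munpack y); rewrite -rmorphM /= -Ey rmorphM /= muniK.
  - by exists (munpack z); rewrite -rmorphM /= -Ez rmorphM /= muniK.
  by exists (muni c); rewrite -(munpackK x) Ec muniM munpackK.
have [u [v [c [c0 E]]]] :=
  coprime_elimination (gcd_domain_mpoly (n := n)) (inj0 _ a0) (inj0 _ b0) cop'.
exists (munpack u), (munpack v), c; split=> //.
rewrite -{1}(muniK a) -{1}(muniK b) -!rmorphM -rmorphD /= E.
by rewrite /munpack map_polyC hornerC.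
Qed.

End FactorialMpoly.

(** * Graded retractions onto linear subspaces *)

Section Retractions.
Variable k : fieldType.

Lemma linear_formE n (F : {mpoly k[n]}) : F \is 1.-homog ->
  F = \sum_i F@_(U_(i)%MM) *: 'X_i.
Proof.
move=> hF; apply/mpolyP => m; rewrite raddf_sum /=.
have [d1 | d1] := eqVneq (mdeg m) 1%N; last first.
  rewrite (dhomog_nemf_coeff hF d1) big1 // => i _.
  rewrite mcoeffZ mcoeffX; case: eqP => [e|]; last by rewrite mulr0.
  by move: d1; rewrite -e /= mdeg1 eqxx.
have /mdeg1P[i /eqP ->] : mdeg m == 1%N by apply/eqP.
rewrite (bigD1 i) //= mcoeffZ mcoeffX eqxx mulr1 big1 ?addr0 // => j ji.
rewrite mcoeffZ mcoeffX; case: eqP => [/mnmP/(_ j)|]; last by rewrite mulr0.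
by rewrite !mnm1E eqxx eq_sym (negbTE ji).
Qed.

Lemma one_variable_homog (F : {mpoly k[1]}) d :
  F \is d.-homog -> exists c : k, F = c *: 'X_ord0 ^+ d.
Proof.
move=> hF; exists F@_(U_(ord0) *+ d)%MM; apply/mpolyP => m.
rewrite mcoeffZ mpolyXn mcoeffX.
have mE : m = (U_(ord0) *+ mdeg m)%MM.
  by apply/mnmP => i; rewrite mulmnE mnm1E !ord1 eqxx mul1n mdegE big_ord1 ord1.
have [e | e] := eqVneq (mdeg m) d; first by rewrite mE e eqxx mulr1.
rewrite (dhomog_nemf_coeff hF e); case: eqP => [E|]; last by rewrite mulr0.
by move: e; rewrite -E mdegMn mdeg1 mul1n eqxx.
Qed.

Lemma homog_mpolyX n (i : 'I_n) : ('X_i : {mpoly k[n]}) \is 1.-homog.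
Proof. by rewrite dhomogX /= mdeg1. Qed.

Lemma homog_prod_expn n (m : 'X_{1..n}) p (f : 'I_n -> {mpoly k[p]}) :
  (forall i, f i \is 1.-homog) -> \prod_i f i ^+ m i \is (mdeg m).-homog.
Proof.
move=> hf; rewrite mdegE; elim/big_rec2: _ => [|i d q _ hq]; first exact: dhomog1.
by apply: dhomogM => //; have := dhomogMn (m i) (hf i); rewrite mul1n.
Qed.

Lemma comp_mpoly_homog n p (t : n.-tuple {mpoly k[p]}) d (F : {mpoly k[n]}) :
  (forall i, tnth t i \is 1.-homog) -> F \is d.-homog -> F \mPo t \is d.-homog.
Proof.
move=> ht hF; rewrite comp_mpolyE big_seq; apply: rpred_sum => m mF.
by apply: rpredZ; rewrite -(dhomog_mf hF mF); apply: homog_prod_expn.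
Qed.

Lemma mwiden_homog n d (F : {mpoly k[n]}) : F \is d.-homog -> mwiden F \is d.-homog.
Proof.
move=> hF; rewrite /mwiden /mmap big_seq; apply: rpred_sum => m mF.
rewrite mul_mpolyC; apply: rpredZ; rewrite -(dhomog_mf hF mF) /mmap1.
by apply: homog_prod_expn => i; apply: homog_mpolyX.
Qed.

(* A graded surjection of polynomial rings with a graded section: its kernel is
   the ideal of a linear subspace. *)
Record retraction m n := Retraction {
  red :> {rmorphism {mpoly k[m]} -> {mpoly k[n]}};
  lft : {rmorphism {mpoly k[n]} -> {mpoly k[m]}};
  lftK : cancel lft red;
  red_homog : forall d p, p \is d.-homog -> red p \is d.-homog;
  lft_homog : forall d p, p \is d.-homog -> lft p \is d.-homog }.

Lemma graded_pihomog m n (f : {rmorphism {mpoly k[m]} -> {mpoly k[n]}}) :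
  (forall d p, p \is d.-homog -> f p \is d.-homog) ->
  forall d p, pihomog mdeg d (f p) = f (pihomog mdeg d p).
Proof.
move=> hf d p.
have hfi i : f (pihomog mdeg i p) \is i.-homog by apply/hf/pihomogP.
have piE (i : 'I_(msize p)) : pihomog mdeg d (f (pihomog mdeg i p)) =
    if i == d :> nat then f (pihomog mdeg d p) else 0.
  have [->|ne] := eqVneq (i : nat) d; first by rewrite pihomog_dE.
  by rewrite (pihomog_ne0 ne).
rewrite {1}(pihomog_partitionE (leqnn (msize p))) [f _]raddf_sum raddf_sum /=.
rewrite (eq_bigr _ (fun i _ => piE i)) -big_mkcond /=.
have [lt | ge] := ltnP d (msize p); first by rewrite (big_pred1 (Ordinal lt)).
rewrite big_pred0; last by move=> i; rewrite ltn_eqF // (leq_trans (ltn_ord i)).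
have -> : pihomog mdeg d p = 0; last by rewrite raddf0.
rewrite pihomogE big_seq_cond big_pred0 // => m'.
apply/negP => /andP[/msize_mdeg_lt lt /eqP e].
by move: lt; rewrite e ltnNge ge.
Qed.

Definition retraction_comp l m n (f : retraction l m) (g : retraction m n) :
  retraction l n.
Proof.
apply: (@Retraction _ _ (red g \o red f) (lft f \o lft g)).
- by move=> p /=; rewrite !lftK.
- by move=> d p hp /=; do 2!apply: red_homog.
- by move=> d p hp /=; do 2!apply: lft_homog.
Defined.

(** The substitution solves l = 0 for a variable ['X_j] that occurs in l; the section renames the
    remaining variables, skipping j. *)
Lemma linear_retraction n (l : {mpoly k[n.+1]}) : l \is 1.-homog -> l != 0 ->
  exists r : retraction n.+1 n, forall F, r F = 0 <-> divides l F.
Proof.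
move=> hl l0; have [j cj] : exists j, l@_(U_(j)%MM) != 0.
  apply/existsP; apply: contraNT l0; rewrite negb_exists => /forallP all0.
  rewrite (linear_formE hl) big1 // => i _.
  by have := all0 i; rewrite negbK => /eqP ->; rewrite scale0r.
pose c i := l@_(U_(i)%MM).
pose t := [tuple if unlift j i is Some i' then 'X_i'
  else - (c j)^-1 *: \sum_i' c (lift j i') *: 'X_i' | i < n.+1] :
  n.+1.-tuple {mpoly k[n]}.
pose s := [tuple 'X_(lift j i) | i < n] : n.-tuple {mpoly k[n.+1]}.
pose f : {rmorphism {mpoly k[n.+1]} -> {mpoly k[n]}} := comp_mpoly t.
pose g : {rmorphism {mpoly k[n]} -> {mpoly k[n.+1]}} := comp_mpoly s.
have fX i : f 'X_i = tnth t i by rewrite /f /= comp_mpolyXU -tnth_nth.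
have gX i : g 'X_i = 'X_(lift j i) by rewrite /g /= comp_mpolyXU -tnth_nth tnth_mktuple.
have fZ a p : f (a *: p) = a *: f p by rewrite /f /= comp_mpolyZ.
have gZ a p : g (a *: p) = a *: g p by rewrite /g /= comp_mpolyZ.
have fl i : f 'X_(lift j i) = 'X_i by rewrite fX tnth_mktuple liftK.
have fj : f 'X_j = - (c j)^-1 *: \sum_i' c (lift j i') *: 'X_i'.
  by rewrite fX tnth_mktuple unlift_none.
have gfK : cancel g f.
  elim/mpolyind => [|a m p _ _ IH]; first by rewrite !rmorph0.
  rewrite !rmorphD IH gZ fZ; congr (_ *: _ + _); rewrite mpolyXE_id !rmorph_prod /=.
  by apply: eq_bigr => i _; rewrite !rmorphXn /= gX fl.
have th i : tnth t i \is 1.-homog.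
  rewrite tnth_mktuple; case: unliftP => [i' _ | _]; first exact: homog_mpolyX.
  by apply/rpredZ/rpred_sum => i' _; apply/rpredZ/homog_mpolyX.
have sh i : tnth s i \is 1.-homog by rewrite tnth_mktuple homog_mpolyX.
pose r := Retraction gfK (fun d p => comp_mpoly_homog th) (fun d p => comp_mpoly_homog sh).
have lE : l = c j *: 'X_j + \sum_i c (lift j i) *: 'X_(lift j i).
  by rewrite {1}(linear_formE hl) (bigD1_ord j).
have rl : f l = 0.
  rewrite lE rmorphD fZ fj scalerA mulrN divff // scaleN1r.
  have -> : f (\sum_i c (lift j i) *: 'X_(lift j i)) = \sum_i c (lift j i) *: 'X_i.
    by rewrite (raddf_sum f); apply: eq_bigr => i _; apply: etrans (fZ _ _) _; rewrite fl.
  by rewrite addNr.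
have XE i : divides l ('X_i - g (f 'X_i)).
  case: (unliftP j i) => [i' -> | ->]; first by rewrite fl gX subrr; apply: divides0.
  exists (c j)^-1%:MP; rewrite fj gZ scaleNr opprK mul_mpolyC lE scalerDr scalerA mulVf //.
  rewrite scale1r (raddf_sum g); congr (_ + _ *: _).
  by apply: eq_bigr => i' _; apply: etrans (gZ _ _) _; rewrite gX.
(* The congruence modulo l is known on variables; it passes to products by A z - B x = (A - B) z + B
   (z - x). *)
have dE F : divides l (F - g (f F)).
  elim/mpolyind: F => [|a m p _ _ IH]; first by rewrite !rmorph0 subr0; apply: divides0.
  rewrite !rmorphD opprD addrACA; apply: dividesD => //.
  rewrite fZ gZ -scalerBr -mul_mpolyC; apply: divides_mull.
  rewrite mpolyXE_id !rmorph_prod /=.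
  elim/big_rec2: _ => [|i x z _ dxz]; first by rewrite subrr; apply: divides0.
  rewrite !rmorphXn /=.
  set A := 'X_i ^+ _; set B := g _ ^+ _.
  have -> : A * z - B * x = (A - B) * z + B * (z - x) by ring.
  apply: dividesD; last exact: divides_mull.
  apply: divides_mulr; rewrite subrXX; exact: divides_mulr.
exists r => F; split=> [F0 | [x ->]].
  by move: (dE F); rewrite -[f F]/(r F) F0 rmorph0 subr0.
by rewrite rmorphM -[r l]/(f l) rl mulr0.
Qed.

End Retractions.

(** * Zeros and linear factors of binary forms *)

Section ClosedPoints.
Variable k : closedFieldType.

(** The dehomogenization P at x_1 = 1 has a root unless it is a nonzero constant. *)
Lemma binary_form_zero (F : {mpoly k[2]}) d : F \is d.-homog -> (0 < d)%N ->
  exists v : 'I_2 -> k, (exists i, v i != 0) /\ F.@[v] = 0.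
Proof.
move=> hF d0; pose i0 : 'I_2 := ord0; pose i1 : 'I_2 := ord_max.
have i01 : i1 != i0 by [].
have evE v : F.@[v] = \sum_(m <- msupp F) F@_m * (v i0 ^+ m i0 * v i1 ^+ m i1).
  rewrite mevalE; apply: eq_bigr => m _; rewrite big_ord_recl big_ord1.
  by congr (_ * (_ * v _ ^+ m _)); apply/val_inj.
have degE m : m \in msupp F -> (m i0 + m i1)%N = d.
  move=> /(dhomog_mf hF) /= <-; rewrite mdegE big_ord_recl big_ord1.
  by congr (_ + m _)%N; apply/val_inj.
pose P := \sum_(m <- msupp F) F@_m *: 'X^(m i0).
have [[x Px] | ] := altP (closed_rootP P).
  exists (fun i => if i == i0 then x else 1); split.
    by exists i1; rewrite (negbTE i01) oner_neq0.
  have : P.[x] = 0 by apply/rootP.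
  rewrite /P horner_sum => <-; rewrite evE; apply: eq_bigr => m _ /=.
  by rewrite hornerZ hornerXn expr1n mulr1.
(* Now F is a multiple of x_1^d, which vanishes at (1 : 0) because d is positive. *)
rewrite negbK => /size_poly1P [c c0 Pc].
exists (fun i => if i == i0 then 1 else 0); split.
  by exists i0; rewrite eqxx oner_neq0.
rewrite evE big_seq big1 // => m mF /=.
have m00 : m i0 = 0%N.
  apply: contraTeq mF => m00; rewrite mcoeff_msupp negbK.
  have : P`_(m i0) = 0 by rewrite Pc coefC (negbTE m00).
  rewrite /P coef_sum; have [mF | /memN_msupp_eq0 ->] := boolP (m \in msupp F); last by [].
  rewrite (bigD1_seq m) ?msupp_uniq //= coefZ coefXn eqxx mulr1 big1_seq ?addr0 => [->//|m'].
  move=> /andP[nm m'F]; rewrite coefZ coefXn; case: eqP => [e|]; last by rewrite mulr0.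
  case/eqP: nm; apply/mnmP => i.
  have : (m' i0 + m' i1 = m i0 + m i1)%N by rewrite !degE.
  rewrite -e => /addnI e1.
  case: i => [[|[|//]] lt].
    by have -> : Ordinal lt = i0 by apply/val_inj.
  by have -> : Ordinal lt = i1 by apply/val_inj.
have m1d : m i1 = d by rewrite -(degE _ mF) m00.
by rewrite m1d expr0n gtn_eqF // !mulr0.
Qed.

(** For a zero v of F, l is the linear form vanishing at v. Modulo l, F becomes c x^d in one
    variable; evaluation at v, where the lift of x is nonzero, gives c = 0. *)
Lemma binary_linear_factor (F : {mpoly k[2]}) d : F \is d.-homog -> (0 < d)%N ->
  exists l, [/\ l \is 1.-homog, l != 0 & divides l F].
Proof.
move=> hF d0; have [v [[i vi] Fv]] := binary_form_zero hF d0.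
pose i0 : 'I_2 := ord0; pose i1 : 'I_2 := ord_max.
pose l : {mpoly k[2]} := v i1 *: 'X_i0 - v i0 *: 'X_i1.
have hl : l \is 1.-homog by apply: rpredB; apply/rpredZ/homog_mpolyX.
have lv : l.@[v] = 0 by rewrite /l mevalB !mevalZ !mevalXU mulrC subrr.
have l0 : l != 0.
  have ne : i1 == i0 = false by [].
  have c0 : l@_(U_(i0)%MM) = v i1.
    rewrite mcoeffB !mcoeffZ !mcoeffX eqxx mulr1.
    by case: eqP => [/mnmP/(_ i1)|_]; rewrite ?mnm1E ?eqxx ?ne // mulr0 subr0.
  have c1 : l@_(U_(i1)%MM) = - v i0.
    rewrite mcoeffB !mcoeffZ !mcoeffX eqxx mulr1.
    by case: eqP => [/mnmP/(_ i1)|_]; rewrite ?mnm1E ?eqxx ?ne // mulr0 sub0r.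
  apply: contraNneq vi => lz; move: c0 c1; rewrite lz !mcoeff0 => c0 /esym/eqP.
  rewrite oppr_eq0 => /eqP c1; case: i => [[|[|//]] lt].
    by rewrite (_ : Ordinal lt = i0) ?c1 //; apply/val_inj.
  by rewrite (_ : Ordinal lt = i1) -?c0 //; apply/val_inj.
have [r rl] := linear_retraction hl l0; exists l; split=> //; apply/rl.
have evl G : r G = 0 -> G.@[v] = 0 by move/rl => [x ->]; rewrite mevalM lv mulr0.
have evE G : G.@[v] = (lft r (r G)).@[v].
  by apply/eqP; rewrite -subr_eq0 -mevalB; apply/eqP/evl; rewrite rmorphB /= lftK subrr.
(* Otherwise every linear form would vanish at v, including the coordinate i with [v i != 0]. *)
have X0 : (lft r 'X_ord0).@[v] != 0.
  apply: contraNneq vi => X0.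
  have [c Ec] := one_variable_homog (red_homog r (homog_mpolyX _ i)).
  by rewrite -(mevalXU v i) evE Ec expr1 -mul_mpolyC !rmorphM /= X0 mulr0.
have [c Ec] := one_variable_homog (red_homog r hF).
apply/eqP; rewrite Ec; have [-> | c0] := eqVneq c 0; first by rewrite scale0r.
have : (lft r c%:MP).@[v] != 0.
  rewrite -unitfE; do 2!apply: rmorph_unit; apply/unitrP; exists c^-1%:MP.
  by rewrite -!mpolyCM mulVf ?divff.
move: Fv; rewrite evE Ec -mul_mpolyC !rmorphM !rmorphXn /= => /eqP.
by rewrite mulf_eq0 expf_eq0 (negbTE X0) andbF orbF => ->.
Qed.

End ClosedPoints.

(** * Common divisors of ideals and prime factors of forms *)

Section CommonDivisors.
Variable k : closedFieldType.

Lemma uniq_seq_exists N : exists s : seq k, uniq s /\ size s = N.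
Proof.
elim: N => [|N [s [us ss]]]; first by exists [::].
have [x xs] : exists x, ~~ root (\prod_(z <- s) ('X - z%:P)) x.
  by apply/closed_nonrootP/monic_neq0/monic_prod => z _; apply: monicXsubC.
by exists (x :: s); rewrite /= us ss -root_prod_XsubC xs.
Qed.

Lemma mpoly_nonunit n (q : {mpoly k[n]}) : q != 0 -> ~ divides q 1 -> (1 < msize q)%N.
Proof.
move=> q0 nq; rewrite ltnNge; apply/negP => /msize1_polyC Eq; apply: nq.
have c0 : q@_0%MM != 0 by apply: contraNneq q0 => e; rewrite Eq e mpolyC0.
by exists (q@_0%MM)^-1%:MP; rewrite Eq mcoeffC eqxx mulr1 -mpolyCM mulVf.
Qed.

(* The common divisors of f and x + t y, for distinct t, are pairwise coprime
   divisors of f; hence all but finitely many of them are units. *)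
Lemma coprime_combination n (f x y : {mpoly k[n]}) : f != 0 ->
  (forall q, divides q f -> divides q x -> divides q y -> divides q 1) ->
  exists t : k, coprime_elts f (x + t *: y).
Proof.
move=> f0 fxy; apply: contrapT => N.
have /choice[q Hq] : forall t : k, exists q, [/\ divides q f, divides q (x + t *: y) & ~ divides q 1].
  move=> t; apply: contrapT => Nt; apply: N; exists t.
  apply: (no_common_factor_coprime (gcd_domain_mpoly (n := n))) => q qf qxy.
  by apply: contrapT => q1; apply: Nt; exists q.
have cop s t : s != t -> coprime_elts (q s) (q t).
  move=> st; apply: (no_common_factor_coprime (gcd_domain_mpoly (n := n))) => d ds dt.
  have [sf sx _] := Hq s; have [tf tx _] := Hq t.
  have dsx := divides_trans ds sx; have dtx := divides_trans dt tx.
  have st0 : s - t != 0 by rewrite subr_eq0.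
  have dy : divides d y.
    have -> : y = (s - t)^-1%:MP * ((x + s *: y) - (x + t *: y)).
      by rewrite opprD addrACA subrr add0r -scalerBl mul_mpolyC scalerA mulVf ?scale1r.
    exact/divides_mull/dividesB.
  apply: fxy => //; first exact: divides_trans tf.
  have -> : x = (x + t *: y) - t%:MP * y by rewrite mul_mpolyC addrK.
  by apply: dividesB => //; apply: divides_mull.
(* This many parameters suffice: the product of so many pairwise coprime nonunit divisors of f would
   divide f and have size larger than [msize f]. *)
have [s [us ss]] := uniq_seq_exists (msize f).
suff [] : divides (\prod_(t <- s) q t) f /\ (size s < msize (\prod_(t <- s) q t))%N.
  move=> [u Eu]; rewrite ss Eu; have u0 : u != 0.
    by apply: contraNneq f0 => u0; rewrite Eu u0 mul0r.
  have p0 : \prod_(t <- s) q t != 0 by apply: contraNneq f0 => p0; rewrite Eu p0 mulr0.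
  by rewrite msizeM // (mpolySpred _ u0) addSn /= ltnNge leq_addl.
elim: s us {ss} => [|t s IH] /=.
  by rewrite big_nil msize1; split=> //; apply: divides1.
move=> /andP[ts us]; have [[u Eu] ps] := IH us; rewrite big_cons.
have [tf _ q1] := Hq t; have q0 := divides_neq0 tf f0.
have p0 : \prod_(i <- s) q i != 0 by apply: contraNneq f0 => p0; rewrite Eu p0 mulr0.
split; last first.
  rewrite msizeM //; have := mpoly_nonunit q0 q1; case: (msize (q t)) => [|[|m]] // _.
  by rewrite !addSn /= ltnS (leq_trans ps) // leq_addl.
have cps : coprime_elts (q t) (\prod_(i <- s) q i).
  have : all (fun i => i != t) s by apply/allP => i si; apply: contraNneq ts => <-.
  elim: (s) => [_|i s' IH'] /=.
    by rewrite big_nil; apply/coprime_eltsC/coprime_unit/divides1.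
  by move=> /andP[it /IH' c]; rewrite big_cons; apply: coprime_mul => //; apply: cop; rewrite eq_sym.
have [v Ev] : divides (q t) u.
  by apply: (coprime_gauss cps); rewrite mulrC -Eu.
by exists v; rewrite Eu Ev mulrA.
Qed.

(** Among the gcds of f with elements z of J, g has minimal size. For y in J, some z + t y has
    gcd(g, y) as its gcd with f, by [coprime_combination]; minimality then forces g to divide y. *)
Lemma ideal_common_divisor n (J : set {mpoly k[n]}) f : is_ideal J -> J f -> f != 0 ->
  exists g a b, [/\ coprime_elts a b, J (a * g), J (b * g)
    & forall x, J x -> divides g x].
Proof.
move=> [J0 JD JM] Jf f0.
pose D g := exists z a b, [/\ J z, f = a * g, z = b * g & coprime_elts a b].
have [g [[z [a [b [Jz Ef Ez cop]]]] gmin]] :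
    exists g, D g /\ forall g', D g' -> (msize g <= msize g')%N.
  have : exists m g, D g /\ (msize g <= m)%N.
    exists (msize f), f; split=> //; exists 0, 1, 0.
    by rewrite mul1r mul0r; split=> //; apply/coprime_unit/divides1.
  move=> [m]; elim/ltn_ind: m => m IH [g [Dg gm]].
  have [[g' [Dg' lt]]|N] := pselect (exists g', D g' /\ (msize g' < msize g)%N).
    by apply: (IH (msize g')); [apply: leq_trans gm | exists g'].
  exists g; split=> // g' Dg'; rewrite leqNgt; apply/negP => lt; apply: N.
  by exists g'.
exists g, a, b; split=> //; rewrite -?Ef -?Ez // => y Jy.
have [h [g' [y' [Eg Ey copy]]]] := gcd_domain_mpoly g y.
have f1 : a * g' != 0 by apply: contraNneq f0 => e; rewrite Ef Eg mulrA e mul0r.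
have [q qa qb qy|t copt] := @coprime_combination n (a * g') (b * g') y' f1.
  by apply: (coprime_common copy) => //; apply: cop.
have Dh : D h.
  exists (z + t *: y), (a * g'), (b * g' + t *: y'); split=> //.
  - by apply: JD => //; rewrite -mul_mpolyC; apply: JM.
  - by rewrite Ef Eg mulrA.
  - by rewrite mulrDl -mulrA -Eg -Ez -scalerAl -Ey.
have g'0 : g' != 0 by apply: contraNneq f1 => ->; rewrite mulr0.
have h0 : h != 0 by apply: contraNneq f0 => e; rewrite Ef Eg e !mulr0.
have [u Eu] : divides g' 1.
  apply: contrapT => /(mpoly_nonunit g'0); apply/negP; rewrite -leqNgt.
  move: (gmin _ Dh); rewrite Eg msizeM // (mpolySpred _ g'0) (mpolySpred _ h0).
  by rewrite addSn /= addnS ltnS -[X in (_ <= X)%N]add0n leq_add2r leqn0 => /eqP->.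
exists (y' * u); rewrite Eg Ey -[h in LHS]mul1r Eu; ring.
Qed.

Lemma homog_unit n (g : {mpoly k[n]}) d : g \is d.-homog -> divides g 1 -> d = 0%N.
Proof.
move=> hg [u Eu]; have g0 : g != 0.
  by apply/eqP=> g0; move/eqP: Eu; rewrite g0 mulr0 oner_eq0.
have h1 : u * g \is 0.-homog by rewrite -Eu; apply: dhomog1.
have [|e he] := homog_factor _ h1; first by rewrite -Eu oner_neq0.
have u0 : u != 0 by apply/eqP=> u0; move/eqP: Eu; rewrite u0 mul0r oner_eq0.
have h2 := dhomogM he hg.
have := dhomog_uniq _ h1 h2; rewrite mulf_neq0 // => /(_ isT) /esym/eqP.
by rewrite addn_eq0 => /andP[_ /eqP].
Qed.

Lemma homog0_unit n (g : {mpoly k[n]}) : g \is 0.-homog -> g != 0 -> divides g 1.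
Proof.
move=> hg g0; have Eg : g = (g@_0%MM)%:MP.
  apply/mpolyP => m; rewrite mcoeffC; have [->|m0] := eqVneq 0%MM m; first by rewrite mulr1.
  by rewrite mulr0 (dhomog_nemf_coeff hg) //= mdeg_eq0 eq_sym.
have c0 : g@_0%MM != 0 by apply: contraNneq g0 => e; rewrite Eg e mpolyC0.
by exists (g@_0%MM)^-1%:MP; rewrite {2}Eg -mpolyCM mulVf.
Qed.

Lemma homog_divides n (g f : {mpoly k[n]}) d : f != 0 -> f \is d.-homog ->
  divides g f -> exists e, g \is e.-homog /\ (e <= d)%N.
Proof.
move=> f0 hf [u Eu]; rewrite Eu in f0 hf.
have [e he] := homog_factor f0 hf.
have [e' he'] : exists e', g \is e'.-homog by apply: (@homog_factor _ _ g u d); rewrite mulrC.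
exists e'; split=> //; rewrite -(dhomog_uniq f0 (dhomogM he he') hf) ?leq_addl //.
Qed.

(* P may be membership in a prime ideal, or being a non-unit. *)
Lemma prime_factor n (P : {mpoly k[n]} -> Prop) g d :
  (forall x y, P (x * y) -> P x \/ P y) -> (forall x, P x -> ~ divides x 1) ->
  g != 0 -> g \is d.-homog -> P g ->
  exists q e, [/\ P q, divides q g, q \is e.-homog &
    forall x y, divides q (x * y) -> divides q x \/ divides q y].
Proof.
move=> Pprime Punit; elim/ltn_ind: d g => d IH g g0 hg Pg.
have [irr|] := pselect (forall a b, g = a * b -> divides a 1 \/ divides b 1).
  exists g, d; split=> //; first exact: divides_refl.
  by move=> x y; apply: (irreducible_is_prime (gcd_domain_mpoly (n := n))).
move=> /existsNP[a /existsNP[b /not_implyP[Eg /not_orP[a1 b1]]]].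
have deg c c' : c * c' = g -> ~ divides c' 1 -> exists2 e, (e < d)%N & c \is e.-homog.
  move=> Ec c1; move: (g0) (hg); rewrite -Ec => cc0 hcc.
  have [e he] := homog_factor cc0 hcc; exists e => //.
  have [e' he'] : exists e', c' \is e'.-homog.
    by apply: (@homog_factor _ _ c' c d); rewrite mulrC.
  rewrite (dhomog_uniq cc0 hcc (dhomogM he he')) -[X in (X < _)%N]addn0 ltn_add2l lt0n.
  apply/eqP => e'0; apply: c1; apply: homog0_unit; first by move: he'; rewrite e'0.
  by apply: contraNneq cc0 => ->; rewrite mulr0.
move: (g0) (Pg); rewrite Eg mulf_eq0 negb_or => /andP[a0 b0] /Pprime[Pa | Pb].
  have [e lt ha] := deg a b (esym Eg) b1.
  have [q [e' [Pq qa hq pq]]] := IH e lt a a0 ha Pa.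
  by exists q, e'; split=> //; apply: divides_mulr.
have [e lt hb] : exists2 e, (e < d)%N & b \is e.-homog.
  by apply: (deg b a) => //; rewrite mulrC.
have [q [e' [Pq qb hq pq]]] := IH e lt b b0 hb Pb.
by exists q, e'; split=> //; apply: divides_mull.
Qed.

End CommonDivisors.

(** * Points of the plane and unmixed ideals *)

Section HomogeneousIdeals.
Variable k : fieldType.

Lemma idealN n (I : set {mpoly k[n]}) f : is_ideal I -> I f -> I (- f).
Proof. by move=> [_ _ IM] If; rewrite -mulN1r; apply: IM. Qed.

Lemma idealB n (I : set {mpoly k[n]}) f g : is_ideal I -> I f -> I g -> I (f - g).
Proof. by move=> iI If Ig; case: (iI) => _ ID _; apply: ID => //; apply: idealN. Qed.

Lemma idealMr n (I : set {mpoly k[n]}) f g : is_ideal I -> I f -> I (f * g).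
Proof. by move=> [_ _ IM] If; rewrite mulrC; apply: IM. Qed.

Lemma ideal_components n (I : set {mpoly k[n]}) f :
  is_ideal I -> (forall d, I (pihomog mdeg d f)) -> I f.
Proof.
move=> [I0 ID _] If; rewrite (pihomog_partitionE (leqnn (msize f))).
by elim/big_rec: _ => // i x _; apply: ID.
Qed.

Lemma homog_component n (I : set {mpoly k[n]}) f : homogeneous_ideal I -> I f -> f != 0 ->
  exists d, I (pihomog mdeg d f) /\ pihomog mdeg d f != 0.
Proof.
move=> [_ hI] If; apply: contra_neqP => N.
rewrite (pihomog_partitionE (leqnn (msize f))) big1 // => i _.
by apply/eqP; apply: contrapT => /negP ne; apply: N; exists i; split=> //; apply: hI.
Qed.

Lemma homogeneous_preim m n (f : {rmorphism {mpoly k[m]} -> {mpoly k[n]}})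
    (I : set {mpoly k[n]}) :
  (forall d p, p \is d.-homog -> f p \is d.-homog) ->
  homogeneous_ideal I -> homogeneous_ideal [set x | I (f x)].
Proof.
move=> hf [[I0 ID IM] hI]; split; first split=> /= [|x y|x y].
- by rewrite rmorph0.
- by rewrite rmorphD; apply: ID.
- by rewrite rmorphM; apply: IM.
by move=> x d /=; rewrite -(graded_pihomog hf); apply: hI.
Qed.

Lemma homogeneous_colon n (I : set {mpoly k[n]}) c e : c \is e.-homog ->
  homogeneous_ideal I -> homogeneous_ideal [set x | I (x * c)].
Proof.
move=> hc [[I0 ID IM] hI]; split; first split=> /= [|x y|x y].
- by rewrite mul0r.
- by rewrite mulrDl; apply: ID.
- by rewrite -mulrA; apply: IM.
by move=> x d /=; rewrite -(pihomogMr _ _ hc); apply: hI.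
Qed.

Lemma homogeneous_kernel m n (r : retraction k m n) :
  homogeneous_ideal [set x | r x = 0].
Proof.
split; first split=> /= [|x y|x y].
- by rewrite rmorph0.
- by rewrite rmorphD => -> ->; rewrite addr0.
- by rewrite rmorphM => ->; rewrite mulr0.
by move=> x d /= rx; rewrite -(graded_pihomog (@red_homog _ _ _ r)) rx raddf0.
Qed.

Lemma prime_idealX n (I : set {mpoly k[n]}) f d : prime_ideal I -> I (f ^+ d) -> I f.
Proof.
move=> [_ I1 IP]; elim: d => [|d IH]; first by rewrite expr0.
by rewrite exprS => /IP[|/IH].
Qed.

End HomogeneousIdeals.

(** * Closed points under ideals containing a coprime pair *)

Section Points.
Variable k : closedFieldType.

(** The linear factors of c are peeled off one by one: either the remaining factor c' still carries
    u into S, or f c' * u is a new element outside S, and the split-off linear form carries it into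
    S. *)
Lemma linear_form_in_colon n (S : set {mpoly k[n]})
    (f : {rmorphism {mpoly k[2]} -> {mpoly k[n]}}) d c u e :
  (forall d p, p \is d.-homog -> f p \is d.-homog) -> is_ideal S ->
  c != 0 -> c \is d.-homog -> u \is e.-homog -> ~ S u -> S (f c * u) ->
  exists l u' e', [/\ l \is 1.-homog, l != 0, u' \is e'.-homog, ~ S u' & S (f l * u')].
Proof.
move=> hf iS; elim: d c u e => [|d IH] c u e c0 hc hu nSu Scu.
  case: nSu; have [v Ev] := homog0_unit hc c0; case: iS => _ _ SM.
  rewrite -[u]mul1r -(rmorph1 f) Ev rmorphM -mulrA; exact: SM.
have [l [hl l0 [c' Ec]]] := binary_linear_factor hc (ltn0Sn d).
have c'0 : c' != 0 by apply: contraNneq c0 => z; rewrite Ec z mul0r.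
have hc' : c' \is d.-homog.
  have [||e' he'] := @homog_factor _ _ c' l d.+1; rewrite -?Ec //.
  move: (hc); rewrite Ec => /(dhomog_uniq _ (dhomogM he' hl)).
  rewrite -Ec addn1 => /(_ c0) [<-] //.
have [Su' | nSu'] := pselect (S (f c' * u)); first exact: (IH c' u e).
exists l, (f c' * u), (d + e)%N; split=> //; first by apply: dhomogM => //; apply: hf.
by rewrite mulrA -rmorphM mulrC -[l * c']mulrC -Ec mulrC.
Qed.

(* Eliminating one variable from a coprime pair puts a binary form into S;
   its linear factors cut the plane down to a line, and the same argument on that
   line cuts it down to a point. *)
Lemma coprime_pair_point (S : set {mpoly k[3]}) a b :
  homogeneous_ideal S -> ~ S 1 -> S a -> S b -> coprime_elts a b ->
  exists (r : retraction k 3 1) c e,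
    [/\ c \is e.-homog, ~ S c & forall x, r x = 0 -> S (x * c)].
Proof.
move=> hS nS1 Sa Sb cop; have [iS _] := hS; have [S0 SD SM] := iS.
have [a0 b0] : a != 0 /\ b != 0.
  have unit0 x : S x -> ~ divides x 1.
    by move=> Sx [u Eu]; apply: nS1; rewrite Eu; apply: SM.
  split; apply/eqP => z.
    apply: (unit0 b) => //; apply: (cop b 1); rewrite ?z ?mul0r ?mulr1.
      exact: divides0.
    exact: divides_refl.
  apply: (unit0 a) => //; apply: (cop a 1); rewrite ?z ?mul0r ?mulr1.
    exact: divides_refl.
  exact: divides0.
have [u [v [c [c0 Ec]]]] := elimination a0 b0 cop.
have Sc : S (mwiden c) by rewrite -Ec; apply: SD; apply: SM.
pose w : {rmorphism {mpoly k[2]} -> {mpoly k[3]}} := @mwiden 2 k.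
have hw := @mwiden_homog k 2.
have [d [Scd cd0]] := homog_component (homogeneous_preim (f := w) hw hS) Sc c0.
have [|l1 [u1 [e1 [hl1 l10 hu1 nSu1 Slu1]]]] :=
  @linear_form_in_colon _ S w d _ 1 0 hw iS cd0 (pihomogP _ _ _) (dhomog1 _ _) nS1.
  by rewrite mulr1.
have wl0 : w l1 != 0 by apply: contra_neq l10 => z; apply: inj_mwiden; rewrite mwiden0.
have [r1 kr1] := linear_retraction (hw _ _ hl1) wl0.
pose S1 := [set x | S (x * u1)].
have hS1 : homogeneous_ideal S1 by apply: (homogeneous_colon hu1 hS).
have [iS1 _] := hS1; have [S10 S1D S1M] := iS1.
pose T := [set t | S1 (lft r1 t)].
have hT : homogeneous_ideal T by apply: (homogeneous_preim _ hS1); apply: lft_homog.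
have S1lft x : S1 (lft r1 (r1 x)) <-> S1 x.
  have [y Ey] : divides (w l1) (x - lft r1 (r1 x)).
    by apply/kr1; rewrite rmorphB lftK subrr.
  have Sd : S1 (x - lft r1 (r1 x)) by rewrite Ey; apply: S1M.
  split=> Sx; first by rewrite -[x](subrK (lft r1 (r1 x))); apply: S1D.
  by rewrite -[lft _ _](subKr x); apply: idealB.
(* The trace on the line is nonzero: if a and b both vanished there, the equation of the line would
   be a common factor. *)
have [t [Tt t0]] : exists t, T t /\ t != 0.
  have Tr x : S x -> T (r1 x) by move=> Sx; apply/S1lft; apply: idealMr.
  have [za | ra] := eqVneq (r1 a) 0; last by exists (r1 a); split=> //; apply: Tr.
  have [zb | rb] := eqVneq (r1 b) 0; last by exists (r1 b); split=> //; apply: Tr.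
  have := coprime_common cop (proj1 (kr1 a) za) (proj1 (kr1 b) zb).
  by move/(homog_unit (hw _ _ hl1)).
have [d' [Ttd td0]] := homog_component hT Tt t0.
pose i2 : {rmorphism {mpoly k[2]} -> {mpoly k[2]}} := idfun.
have nT1 : ~ T 1 by rewrite /T /S1 /= rmorph1 mul1r.
have [||l2 [u2 [e2 [hl2 l20 hu2 nTu2 Tlu2]]]] :=
  @linear_form_in_colon _ T i2 d' _ 1 0 _ (proj1 hT) td0 (pihomogP _ _ _) (dhomog1 _ _) nT1.
- by [].
- by rewrite mulr1.
have [r2 kr2] := linear_retraction hl2 l20.
exists (retraction_comp r1 r2), (lft r1 u2 * u1), (e2 + e1)%N; split=> //.
  by apply: dhomogM => //; apply: lft_homog.
move=> x /= /kr2 [y Ey]; rewrite mulrA; apply/(S1lft (x * lft r1 u2)).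
suff : T (r1 (x * lft r1 u2)) by [].
by rewrite rmorphM lftK Ey -mulrA; case: (proj1 hT) => _ _; apply.
Qed.

End Points.

(** * Closed points as kernels of retractions onto one variable *)

Section KernelPoints.
Variable k : closedFieldType.

Definition kernel m n (r : retraction k m n) : set {mpoly k[m]} := [set F | r F = 0].

Lemma kernel_lft m n (r : retraction k m n) F : kernel r (F - lft r (r F)).
Proof. by rewrite /kernel /= rmorphB lftK subrr. Qed.

Lemma mpolyX_neq0 n (i : 'I_n) : ('X_i : {mpoly k[n]}) != 0.
Proof.
by apply/eqP=> /(congr1 (fun p => p@_(U_(i)%MM))) /eqP; rewrite mcoeffX eqxx mcoeff0 oner_eq0.
Qed.

Lemma ideal_linear_form n (I : set {mpoly k[n]}) F : is_ideal I ->
  (forall i, I 'X_i) -> F \is 1.-homog -> I F.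
Proof.
move=> [I0 ID IM] IX hF; rewrite (linear_formE hF).
by elim/big_rec: _ => // i x _ Ix; apply: ID => //; rewrite -mul_mpolyC; apply: IM.
Qed.

Lemma kernel_point m n (r : retraction k m n.+1) : proj_point (kernel r).
Proof.
have [iK hK] := homogeneous_kernel r; split=> //.
  split=> //; first by rewrite /kernel /= rmorph1; apply/eqP/oner_neq0.
  move=> f g; rewrite /kernel /= rmorphM => /eqP.
  by rewrite mulf_eq0 => /orP[] /eqP; [left | right].
apply: contrapT => N; have KX i : kernel r 'X_i.
  by apply: contrapT => ?; apply: N; exists i.
have := ideal_linear_form iK KX (lft_homog r (homog_mpolyX _ ord0)).
by rewrite /= lftK => /eqP; rewrite (negbTE (mpolyX_neq0 _)).
Qed.

Lemma homog_mod_kernel n (r : retraction k n 1) F d : F \is d.-homog ->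
  exists c : k, kernel r (F - lft r (c *: 'X_ord0 ^+ d)).
Proof.
move=> hF; have [c Ec] := one_variable_homog (red_homog r hF); exists c.
by rewrite -Ec; apply: kernel_lft.
Qed.

Lemma lft_scaled_inv n (r : retraction k n 1) (I : set {mpoly k[n]}) (c : k) d u :
  is_ideal I -> c != 0 -> I (lft r (c *: 'X_ord0 ^+ d) * u) -> I (lft r 'X_ord0 ^+ d * u).
Proof.
move=> [_ _ IM] c0; rewrite -mul_mpolyC rmorphM rmorphXn -mulrA.
set y := _ ^+ d * u => Iy; have -> : y = lft r c^-1%:MP * (lft r c%:MP * y).
  by rewrite mulrA -rmorphM -mpolyCM mulVf // rmorph1 mul1r.
exact: IM.
Qed.

(** Modulo the kernel every form of degree d is a multiple of the d-th power of one coordinate. A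
    larger prime contains such a power, hence the coordinate, hence all variables. *)
Lemma kernel_maximal n (r : retraction k n 1) p :
  proj_point p -> kernel r `<=` p -> p = kernel r.
Proof.
move=> [hp pp [i pi]] Kp; have [[ip ip1 _] [_ hI]] := (pp, hp).
apply/seteqP; split=> // F pF; apply: contrapT => KF.
have [d Kd] : exists d, ~ kernel r (pihomog mdeg d F).
  apply: contrapT => N; apply: KF; apply: ideal_components => [|d].
    by have [] := homogeneous_kernel r.
  by apply: contrapT => ?; apply: N; exists d.
have [c Kc] := homog_mod_kernel r (pihomogP _ d F).
have [c0 | c0] := eqVneq c 0.
  by apply: Kd; move: Kc; rewrite c0 scale0r rmorph0 subr0.
have : p (lft r (c *: 'X_ord0 ^+ d)).
  rewrite -(subKr (pihomog mdeg d F) (lft _ _)); apply: idealB => //; first exact: hI.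
  exact: Kp.
rewrite -[lft r _]mulr1 => /(lft_scaled_inv ip c0); rewrite mulr1 => /(prime_idealX pp) pX.
have [e Ke] := homog_mod_kernel r (homog_mpolyX k i).
apply: pi; rewrite -[X in p X](subrK (lft r (e *: 'X_ord0 ^+ 1))).
case: (ip) => _ pD pM; apply: pD; first exact: Kp.
by rewrite -mul_mpolyC rmorphM; apply: pM.
Qed.

Lemma kernel_dim0 n (r : retraction k n 1) : ~ dim_ge (kernel r) 1.
Proof.
move=> [p [pP pS]]; have [[P0 K0] [P1 K1]] := (pP 0%N isT, pP 1%N isT).
have [_ ne] := pS 0%N isT; apply: ne.
by rewrite (kernel_maximal P0 K0) (kernel_maximal P1 K1).
Qed.

(** The elements some power of which carries u into I form an ideal, so the test on variables
    extends to all linear forms. This makes saturation independent of coordinates. *)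
Lemma saturation_linear_form n (I : set {mpoly k[n]}) u F : is_ideal I ->
  saturation I u -> F \is 1.-homog -> exists N, I (F ^+ N * u).
Proof.
move=> iI su; have [I0 ID IM] := iI.
apply: (ideal_linear_form (I := [set F | exists N, I (F ^+ N * u)])); last exact: su.
split=> [|f g [N IN] [M IM']|f g [N IN]].
- by exists 1%N; rewrite expr1 mul0r.
(* Each term of the binomial expansion contains f to a power at least N or g to a power at least
   M. *)
- exists (N + M)%N; rewrite exprDn mulr_suml.
  elim/big_rec: _ => // i x _ Ix; apply: ID => //.
  rewrite -mulr_natl -!mulrA; apply: (IM).
  have [le | lt] := leqP M i.
    by rewrite -(subnK le) exprD -!mulrA; do 2!apply: (IM).
  have leN : (N <= N + M - i)%N by rewrite -addnBA ?leq_addr // ltnW.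
  by rewrite -(subnK leN) exprD mulrCA -!mulrA; do 2!apply: (IM).
by exists N; rewrite exprMn -mulrA; apply: (IM).
Qed.

Lemma coprime_variables n (i j : 'I_n) N M : i != j ->
  coprime_elts ('X_i ^+ N : {mpoly k[n]}) ('X_j ^+ M).
Proof.
move=> ij; suff cop : coprime_elts ('X_i : {mpoly k[n]}) 'X_j.
  have copX x y L : coprime_elts x y -> coprime_elts x (y ^+ L : {mpoly k[n]}).
    move=> c; elim: L => [|L IH]; first by apply/coprime_eltsC/coprime_unit/divides1.
    by rewrite exprS; apply: coprime_mul.
  by apply/copX/coprime_eltsC/copX/coprime_eltsC.
apply: (no_common_factor_coprime (gcd_domain_mpoly (n := n))) => q [u Eu] qj.
have [Xi0 hXi] := (mpolyX_neq0 i, homog_mpolyX k i).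
rewrite Eu in Xi0 hXi; have [e hu] := homog_factor Xi0 hXi.
have [e' hq] : exists e', q \is e'.-homog by apply: (@homog_factor _ _ q u 1); rewrite mulrC.
have /eqP := dhomog_uniq Xi0 hXi (dhomogM hu hq).
move: Xi0; rewrite mulf_eq0 negb_or => /andP[u0 q0].
case: e hu => [|e] hu; last first.
  by rewrite addSn eqSS eq_sym addn_eq0 => /andP[_ /eqP e0]; apply: homog0_unit => //; move: hq; rewrite e0.
move=> _; have [v Ev] := homog0_unit hu u0.
have : divides 'X_i ('X_j : {mpoly k[n]}).
  apply: divides_trans qj; exists v; by rewrite Eu mulrA -Ev mul1r.
move=> [w Ew]; have /(congr1 (meval (fun l => (l == j)%:R : k))) := Ew.
by rewrite mevalM !mevalXU eqxx (negbTE ij) mulr0 => /eqP; rewrite oner_eq0.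
Qed.

End KernelPoints.

(** * Homogeneous primes of the plane H *)

Section PlanePoints.
Variables (k : closedFieldType) (h : {mpoly k[4]}) (r : retraction k 4 3).
Hypothesis rker : forall F, r F = 0 <-> divides h F.
Notation s := (lft r).
Implicit Types (p I X : set {mpoly k[4]}) (J S : set {mpoly k[3]}).

(** The ideal in the ring of the ambient space of the subscheme of H with ideal J in A. *)
Definition extension J : set {mpoly k[4]} := [set F | J (r F)].

Lemma red_h : r h = 0.
Proof. by apply/rker; apply: divides_refl. Qed.

Lemma lft_mod_h F : divides h (F - s (r F)).
Proof. exact/rker/kernel_lft. Qed.

Lemma ideal_mod_h I F : is_ideal I -> I h -> I F <-> I (s (r F)).
Proof.
move=> iI Ih; have Id : I (F - s (r F)).
  by have [x ->] := lft_mod_h F; case: (iI) => _ _; apply.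
split=> IF; first by rewrite -[s _](subKr F); apply: idealB.
by rewrite -[F](subrK (s (r F))); case: (iI) => _ ID _; apply: ID.
Qed.

Lemma trace_homogeneous I : homogeneous_ideal I -> homogeneous_ideal [set x | I (s x)].
Proof. by apply: homogeneous_preim; apply: lft_homog. Qed.

Lemma extension_homogeneous J : homogeneous_ideal J -> homogeneous_ideal (extension J).
Proof. by apply: homogeneous_preim; apply: red_homog. Qed.

Definition prime_elt n (q : {mpoly k[n]}) := [/\ q != 0, ~ divides q 1
  & forall x y, divides q (x * y) -> divides q x \/ divides q y].

Lemma prime_elt_divides n (q q' : {mpoly k[n]}) :
  prime_elt q -> ~ divides q' 1 -> divides q' q -> divides q q'.
Proof.
move=> [q0 _ qP] q'1 [u Eu]; have : divides q (u * q') by rewrite -Eu; apply: divides_refl.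
move=> /qP[[v Ev]|//]; case: q'1; exists v; apply: (mulfI q0).
by rewrite mulr1 {1}Eu Ev; ring.
Qed.

Lemma principal_homogeneous n (q : {mpoly k[n]}) d : q \is d.-homog ->
  homogeneous_ideal [set x | divides q x].
Proof.
move=> hq; split; first split=> /= [|x y|x y].
- exact: divides0.
- exact: dividesD.
- exact: divides_mull.
move=> x e /= [y ->]; have [lt | le] := ltnP e d.
  by rewrite (pihomogMr_lt _ hq lt); apply: divides0.
by rewrite -(subnK le) (pihomogMr _ _ hq); apply/divides_mull/divides_refl.
Qed.

(** In A this expresses that S has codimension at least two or is the unit ideal. *)
Definition has_coprime_pair n (S : set {mpoly k[n]}) :=
  exists a b, [/\ S a, S b & coprime_elts a b].

Lemma pair_point p : proj_point p -> p h -> has_coprime_pair [set x | p (s x)] ->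
  exists t : retraction k 4 1, p = kernel t.
Proof.
move=> pP ph [a [b [pa pb cop]]]; have [hp [ip p1 pm] _] := pP.
have [|t [c [e [hc nc tc]]]] := coprime_pair_point (trace_homogeneous hp) _ pa pb cop.
  by rewrite /= rmorph1.
exists (retraction_comp r t); apply: kernel_maximal => // F /= /tc /=.
by rewrite rmorphM => /pm[|//]; move/(ideal_mod_h F ip ph).
Qed.

(** The cases are closed points, the generic point of H, and generic points of plane curves. If the
    common divisor g of the trace is not in p, primality puts its coprime cofactors a and b in p. *)
Lemma point_cases p : proj_point p -> p h ->
  [\/ has_coprime_pair [set x | p (s x)], forall x, p (s x) -> x = 0
    | exists q, prime_elt q /\ forall x, p (s x) <-> divides q x].
Proof.
move=> [hp [ip p1 pm] _] ph.
have [[x [px x0]]|N] := pselect (exists x, p (s x) /\ x != 0); last first.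
  by apply: Or32 => x px; apply/eqP; apply: contrapT => /negP x0; apply: N; exists x.
have [it _] := trace_homogeneous hp.
have [g [a [b [cop pa pb pg]]]] := ideal_common_divisor it px x0.
have [pg' | npg] := pselect (p (s g)); last first.
  apply: Or31; exists a, b; split=> //=.
    by move: pa; rewrite /= rmorphM => /pm[].
  by move: pb; rewrite /= rmorphM => /pm[].
have gE z : p (s z) <-> divides g z.
  split=> [/pg//|[u ->]]; rewrite rmorphM; case: ip => _ _; exact.
apply: Or33; exists g; split=> //; split=> [||y z].
- by apply: contraNneq x0 => g0; have [u ->] := pg x px; rewrite g0 mulr0.
- by move/gE; rewrite rmorph1.
- by rewrite -!gE rmorphM; apply: pm.
Qed.

Lemma prime_point q d : prime_elt q -> q \is d.-homog ->
  proj_point (extension [set x | divides q x]).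
Proof.
move=> [q0 q1 qP] hq; have hE := extension_homogeneous (principal_homogeneous hq).
split=> //; first split; first by case: hE.
- by rewrite /extension /= rmorph1.
- by move=> f g; rewrite /extension /= rmorphM; apply: qP.
apply: contrapT => N; apply: q1.
have qX (i : 'I_3) : divides q 'X_i.
  rewrite -(lftK r 'X_i); apply: (ideal_linear_form (proj1 hE)).
    by move=> j; apply: contrapT => ?; apply: N; exists j.
  exact/lft_homog/homog_mpolyX.
have cop := @coprime_variables k 3 ord0 ord_max 1 1 isT.
by apply: (coprime_common cop); rewrite expr1.
Qed.

(** The point lies on the coordinate line x_i = 0, at a zero of the restriction of q. Choosing i
    such that q does not divide x_i makes the inclusion strict. *)
Lemma plane_curve_point (q : {mpoly k[3]}) d : q \is d.-homog -> (0 < d)%N ->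
  exists t : retraction k 4 1, extension [set x | divides q x] `<` kernel t.
Proof.
move=> hq d0.
have [i qi] : exists i : 'I_3, ~ divides q 'X_i.
  apply: contrapT => N.
  have qX (i : 'I_3) : divides q 'X_i by apply: contrapT => ?; apply: N; exists i.
  have cop := @coprime_variables k 3 ord0 ord_max 1 1 isT.
  have q1 : divides q 1 by apply: (coprime_common cop); rewrite expr1.
  by move: d0; rewrite (homog_unit hq q1).
have [r1 kr1] := linear_retraction (homog_mpolyX k i) (mpolyX_neq0 k i).
have [l [hl l0 lq]] := binary_linear_factor (red_homog r1 hq) d0.
have [r2 kr2] := linear_retraction hl l0.
exists (retraction_comp r (retraction_comp r1 r2)); split.
  move=> F /= [u Eu]; rewrite /kernel /= Eu !rmorphM.
  by rewrite (_ : r2 (r1 q) = 0) ?mulr0 //; apply/kr2.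
move/(_ (s 'X_i)); rewrite /extension /kernel /= !lftK => H; apply/qi/H.
by rewrite (_ : r1 'X_i = 0) ?rmorph0 //; apply/kr1/divides_refl.
Qed.

(** The form x excludes the generic point of H. Since closed points are maximal, p0 and p1 are both
    given by prime elements, and one prime element dividing another is associated to it. *)
Lemma no_long_chain p0 p1 p2 x : proj_point p0 -> proj_point p1 -> proj_point p2 ->
  p0 h -> p0 (s x) -> x != 0 -> p0 `<` p1 -> p1 `<` p2 -> False.
Proof.
move=> P0 P1 P2 p0h p0x x0 [le01 ne01] [le12 ne12].
have p1h := le01 _ p0h.
have kmax p q : proj_point p -> proj_point q -> p h ->
    has_coprime_pair [set x | p (s x)] -> p `<=` q -> q `<=` p.
  by move=> pP qP ph pair pq; have [t Et] := pair_point pP ph pair;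
    rewrite Et in pq *; rewrite (kernel_maximal qP pq).
have [pair | z | [q1 [[q10 q11 q1P] q1E]]] := point_cases P1 p1h.
- by apply: ne12; apply: kmax pair le12.
- by move: x0; rewrite (z x) ?eqxx //; apply: le01.
have [pair | z | [q0 [q0P q0E]]] := point_cases P0 p0h.
- by apply: ne01; apply: kmax pair le01.
- by move: x0; rewrite (z x) ?eqxx.
have [[_ [i0 _ _] _] [_ [i1 _ _] _]] := (P0, P1).
apply: ne01 => F /(ideal_mod_h F i1 p1h)/q1E q1F; apply/(ideal_mod_h F i0 p0h)/q0E.
apply: divides_trans q1F; apply: prime_elt_divides => //.
by apply/q1E/le01/q0E/divides_refl.
Qed.

End PlanePoints.

(** * Curves and zero-dimensional schemes in terms of coprime pairs *)

Section UnmixedIdeals.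
Variables (k : closedFieldType) (h : {mpoly k[4]}) (r : retraction k 4 3).
Hypothesis h_linear : h \is 1.-homog.
Hypothesis rker : forall F, r F = 0 <-> divides h F.
Notation s := (lft r).
Implicit Types (p I X : set {mpoly k[4]}) (J S : set {mpoly k[3]}).

(* For X containing h^2: no associated prime of X has a coprime pair in its trace
   on the plane, i.e. X has no associated closed or irrelevant point. *)
Definition unmixed X := forall S, homogeneous_ideal S -> has_coprime_pair S ->
  forall u, X (h * u) -> (forall x, S x -> X (s x * u)) -> X u.

Lemma pair_ideal_homogeneous (a b : {mpoly k[3]}) d e : a \is d.-homog -> b \is e.-homog ->
  homogeneous_ideal [set x | exists y z, x = y * a + z * b].
Proof.
have piM (c x : {mpoly k[3]}) i j : c \is j.-homog -> exists y, pihomog mdeg i (x * c) = y * c.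
  move=> hc; have [lt | le] := ltnP i j.
    by exists 0; rewrite (pihomogMr_lt _ hc lt) mul0r.
  by exists (pihomog mdeg (i - j) x); rewrite -(pihomogMr _ _ hc) subnK.
move=> ha hb; split; first split=> /= [|x y|x y].
- by exists 0, 0; rewrite !mul0r addr0.
- by move=> [y1 [z1 ->]] [y2 [z2 ->]]; exists (y1 + y2), (z1 + z2); ring.
- by move=> [y1 [z1 ->]]; exists (x * y1), (x * z1); ring.
move=> x i /= [y [z ->]]; rewrite pihomogD.
have [y' ->] := piM a y i d ha; have [z' ->] := piM b z i e hb.
by exists y', z'.
Qed.

Lemma unmixed_pair X a b d e u : is_ideal X -> unmixed X ->
  a \is d.-homog -> b \is e.-homog -> coprime_elts a b ->
  X (h * u) -> X (s a * u) -> X (s b * u) -> X u.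
Proof.
move=> [X0 XD XM] uX ha hb cop Xh Xa Xb; apply: (uX _ (pair_ideal_homogeneous ha hb)) => //.
  by exists a, b; split=> //; [exists 1, 0 | exists 0, 1]; ring.
move=> x [y [z ->]]; rewrite rmorphD !rmorphM mulrDl -!mulrA.
by apply: XD; apply: XM.
Qed.

Lemma unmixed_saturated X : is_ideal X -> unmixed X -> X (h * h) -> saturation X = X.
Proof.
move=> iX uX Xhh; have [X0 XD XM] := iX; apply/seteqP; split=> u; last first.
  by move=> Xu i; exists 0%N; apply: XM.
move=> satu.
have hX i : s ('X_i) \is 1.-homog by apply/lft_homog/homog_mpolyX.
have [N XN] := saturation_linear_form iX satu (hX ord0).
have [M XM'] := saturation_linear_form iX satu (hX ord_max).
have cop := @coprime_variables k 3 ord0 ord_max N M isT.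
have step v : X (h * v) -> X (s 'X_ord0 ^+ N * v) -> X (s 'X_ord_max ^+ M * v) -> X v.
  rewrite -!rmorphXn; apply: (unmixed_pair (d := 1 * N) (e := 1 * M)) => //;
  exact/dhomogMn/homog_mpolyX.
(* Cancellation requires h u in X beforehand, so it is applied to h u as well, where h (h u) lies in
   X because h^2 does. *)
apply: (step) => //; apply: step.
- by rewrite mulrA mulrC; apply: XM.
- by rewrite mulrCA; apply: XM.
- by rewrite mulrCA; apply: XM.
Qed.

Lemma homogeneous_colonl n (X : set {mpoly k[n]}) u e : u \is e.-homog ->
  homogeneous_ideal X -> ideal_colon X (principal u) = [set F | X (F * u)].
Proof.
move=> hu [[_ _ XM] _]; apply/seteqP; split=> F /=.
  by apply; exists 1; rewrite mul1r.
by move=> XF G [y ->]; rewrite mulrCA; apply: XM.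
Qed.

(** If a homogeneous component v of u is outside X, then X : v has a coprime pair in its trace, and
    a multiple w of v has a closed point as its annihilator modulo X. That point is associated,
    hence generic, and purity gives it dimension one. *)
Lemma curve_unmixed X : curve X -> unmixed X.
Proof.
move=> [[hX satX] [_ pureX] embX] S hS [a [b [Sa Sb cop]]] u Xhu XSu.
have [iX piX] := hX; have [X0 XD XM] := iX.
apply: ideal_components => // d; apply: contrapT => nXu.
pose v := pihomog mdeg d u; have hv : v \is d.-homog by apply: pihomogP.
have Xhv : X (h * v).
  by rewrite mulrC -(pihomogMr _ _ h_linear) mulrC; apply: piX.
have XSv x : S x -> X (s x * v).
  move=> Sx; rewrite (pihomog_partitionE (leqnn (msize x))) raddf_sum mulr_suml.
  elim/big_rec: _ => // i y _ Xy; apply: XD => //.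
  have hx := lft_homog r (pihomogP mdeg i x).
  by rewrite mulrC -(pihomogMr _ _ hx) mulrC; apply/piX/XSu/(proj2 hS).
have hT : homogeneous_ideal [set x | X (s x * v)].
  by apply: (homogeneous_preim _ (homogeneous_colon hv hX)); apply: lft_homog.
have [|t [c [e [hc nc tc]]]] := coprime_pair_point hT _ (XSv _ Sa) (XSv _ Sb) cop.
  by rewrite /= rmorph1 mul1r.
pose w := s c * v; have hw : w \is (e + d).-homog by apply: dhomogM => //; apply: lft_homog.
have hXw := homogeneous_colon hw hX.
pose p := kernel (retraction_comp r t).
have Kw F : p F -> X (F * w).
  move=> /= /tc; rewrite /= rmorphM -mulrA -/w => XF.
  have [y Ey] := lft_mod_h rker F.
  rewrite -[F](subrK (s (r F))) mulrDl; apply: XD => //.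
  by rewrite Ey -mulrA; apply: (XM); rewrite /w mulrCA; apply: XM.
(* A colon larger than p would contain a power of the coordinate that survives modulo p, hence the
   same power of every variable; saturation would then put w in X. *)
have pw : p = ideal_colon X (principal w).
  rewrite (homogeneous_colonl hw hX); apply/seteqP; split=> F; first exact: Kw.
  move=> /= XF; apply: contrapT => nF; apply: nc => /=; rewrite -/w.
  have [j nFj] : exists j, ~ p (pihomog mdeg j F).
    apply: contrapT => N; apply: nF; apply: ideal_components => [|j].
      by have [] := homogeneous_kernel (retraction_comp r t).
    by apply: contrapT => ?; apply: N; exists j.
  pose y c := lft (retraction_comp r t) (c *: 'X_ord0 ^+ j).
  have [c' Kc'] := homog_mod_kernel (retraction_comp r t) (pihomogP mdeg j F).
  have [c'0 | c'0] := eqVneq c' 0.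
    by case: nFj; move: Kc'; rewrite c'0 scale0r rmorph0 subr0.
  have Xy : X (y c' * w).
    rewrite -[y c'](subKr (pihomog mdeg j F)) mulrBl; apply: idealB => //; last exact: Kw.
    exact: (proj2 hXw F j XF).
  rewrite -satX => i; exists j.
  have hXj : ('X_i : {mpoly k[4]}) ^+ j \is j.-homog.
    by move: (dhomogMn j (homog_mpolyX k i)); rewrite mul1n.
  have [c2 Kc2] := homog_mod_kernel (retraction_comp r t) hXj.
  rewrite -['X_i ^+ j](subrK (y c2)) mulrDl; apply: XD; first exact: Kw.
  rewrite /y -mul_mpolyC rmorphM -mulrA rmorphXn; apply: XM.
  exact: (lft_scaled_inv iX c'0).
have ass : associated_point X p by split; [apply: kernel_point | exists w].
by have [] := pureX _ (embX _ ass) => /kernel_dim0.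
Qed.

(** The chain is the plane, a line in it and a point on that line. *)
Lemma dim_ge_plane X : (forall F, X F -> r F = 0) -> dim_ge X 2.
Proof.
move=> Xr.
have strict l m n (f : retraction k l m.+1) (g : retraction k m.+1 n) (x : {mpoly k[m.+1]}) :
    x != 0 -> g x = 0 -> kernel f `<` kernel (retraction_comp f g).
  move=> x0 gx; split=> [F /= fF | /(_ (lft f x))]; first by rewrite /kernel /= fF rmorph0.
  by rewrite /kernel /= lftK gx => /(_ erefl) /eqP; rewrite (negbTE x0).
have [r1 kr1] := linear_retraction (homog_mpolyX k (ord0 : 'I_3)) (mpolyX_neq0 k _).
have [r2 kr2] := linear_retraction (homog_mpolyX k (ord0 : 'I_2)) (mpolyX_neq0 k _).
pose t1 := retraction_comp r r1; pose t2 := retraction_comp t1 r2.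
have lt1 : kernel r `<` kernel t1.
  by apply: (strict _ _ _ _ _ 'X_ord0) (mpolyX_neq0 k _) _; apply/kr1/divides_refl.
have lt2 : kernel t1 `<` kernel t2.
  by apply: (strict _ _ _ _ _ 'X_ord0) (mpolyX_neq0 k _) _; apply/kr2/divides_refl.
exists (fun i => if i == 0%N then kernel r else if i == 1%N then kernel t1 else kernel t2).
split=> [[|[|[|//]]] _ | [|[|//]] _] //=.
- by split=> //; apply: kernel_point.
- by split; [apply: kernel_point | move=> F /Xr; case: lt1 => + _; apply].
- split; [exact: kernel_point | move=> F /Xr; case: lt1 => + _ => /[apply]].
  by case: lt2 => + _; apply.
Qed.

Lemma curve_not_plane X : curve X -> exists F, X F /\ r F != 0.
Proof.
move=> [_ [[_ ndim] _] _]; apply: contrapT => N; apply/ndim/dim_ge_plane => F XF.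
by apply/eqP; apply: contrapT => /negP ?; apply: N; exists F.
Qed.

Lemma prime_point_dim q d : prime_elt q -> q \is d.-homog ->
  dim_eq (extension r [set x | divides q x]) 1.
Proof.
move=> qP hq; have P0 := prime_point r qP hq; have [q0 q1 _] := qP.
have d0 : (0 < d)%N.
  by rewrite lt0n; apply/eqP => d0; apply: q1; apply: homog0_unit => //; move: hq; rewrite d0.
have [t lt] := plane_curve_point r hq d0; split.
  exists (fun i => if i == 0%N then extension r [set x | divides q x] else kernel t).
  split=> [[|[|//]] _ | [|//] _] //=; first by split.
  by split; [apply: kernel_point | case: lt].
move=> [p [pP pS]].
have [[P0' E0] [P1' _] [P2' _]] := And3 (pP 0%N isT) (pP 1%N isT) (pP 2%N isT).
apply: (no_long_chain rker P0' P1' P2' _ _ q0 (pS 0%N isT) (pS 1%N isT)); apply: E0.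
  by rewrite /extension /= (red_h rker); apply: divides0.
by rewrite /extension /= lftK; apply: divides_refl.
Qed.

Lemma nonunit_prime_factor n (g : {mpoly k[n]}) d : g != 0 -> g \is d.-homog ->
  ~ divides g 1 -> exists q e, [/\ prime_elt q, q \is e.-homog, (0 < e)%N & divides q g].
Proof.
move=> g0 hg g1; have nonunitM (x y : {mpoly k[n]}) :
    ~ divides (x * y) 1 -> ~ divides x 1 \/ ~ divides y 1.
  move=> n1; apply: contrapT => /not_orP[/contrapT x1 /contrapT y1]; apply: n1.
  by rewrite -[1]mulr1; apply: divides_mul.
have [|q [e [q1 qg hq qP]]] := prime_factor (P := fun x => ~ divides x 1) nonunitM _ g0 hg g1.
  by [].
have q0 := divides_neq0 qg g0; exists q, e; split=> //.
rewrite lt0n; apply/eqP => e0; apply: q1; apply: homog0_unit q0.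
by move: hq; rewrite e0.
Qed.

(** Here w is an equation of the support: the plane curve w = 0 lies in X and every point of X lies
    on it. So generic points of X come from prime factors of w, while [unmixed] excludes associated
    closed points. *)
Lemma curve_criterion X w d : homogeneous_ideal X -> X (h * h) -> unmixed X ->
  w \is d.-homog -> w != 0 -> ~ divides w 1 -> (forall F, X F -> divides w (r F)) ->
  (forall p, proj_point p -> p h -> X `<=` p -> p (s w)) -> curve X.
Proof.
move=> hX Xhh uX hw w0 w1 Xw pw; have [iX _] := hX.
have point_h p : point_of X p -> p h.
  by move=> [[_ pp _] Xp]; apply: (prime_idealX (d := 2) pp); rewrite expr2; apply: Xp.
have point_w p : point_of X p -> p (s w).
  by move=> Pp; have [P Xp] := Pp; apply: pw => //; apply: point_h.
have pt_dim p0 p1 p2 : point_of X p0 -> proj_point p1 -> proj_point p2 ->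
    p0 `<` p1 -> p1 `<` p2 -> False.
  move=> X0 P1 P2; apply: (no_long_chain rker (proj1 X0) P1 P2 _ _ w0).
    exact: point_h.
  exact: point_w.
have prime_pt p : proj_point p -> p (s w) -> exists q e,
    [/\ prime_elt q, q \is e.-homog, divides q w & p (s q)].
  move=> [_ [ip p1 pm] _] pw'.
  have [|x px x1|q [e [pq qw hq qP]]] := prime_factor (P := fun x => p (s x)) _ _ w0 hw pw'.
  - by move=> x y; rewrite rmorphM; apply: pm.
  - case: x1 => y Ey; apply: p1; rewrite -(rmorph1 s) Ey rmorphM.
    by case: ip => _ _; apply.
  exists q, e; split=> //; split=> //; first exact: divides_neq0 w0.
  move=> [y Ey]; apply: p1; rewrite -(rmorph1 s) Ey rmorphM.
  by case: ip => _ _; apply.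
have prime_of q e : prime_elt q -> q \is e.-homog -> divides q w ->
    point_of X (extension r [set x | divides q x]).
  move=> qP hq qw; split; first exact: prime_point hq.
  by move=> F /Xw wF; apply: divides_trans wF.
have ext_le p q : proj_point p -> p h -> p (s q) -> extension r [set x | divides q x] `<=` p.
  move=> [_ [ip _ _] _] ph pq F /= [y Ey]; apply/(ideal_mod_h rker F ip ph).
  by rewrite Ey rmorphM; case: (ip) => _ _; apply.
have generic_prime p : generic_point X p -> exists q e,
    [/\ prime_elt q, q \is e.-homog & p = extension r [set x | divides q x]].
  move=> [Xp pmin]; have [q [e [qP hq qw pq]]] := prime_pt p (proj1 Xp) (point_w _ Xp).
  exists q, e; split=> //; apply/esym/pmin; first exact: (prime_of q e).
  by apply: ext_le => //; [case: Xp | apply: point_h].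
split.
- by split=> //; apply: unmixed_saturated.
- split; last by move=> p /generic_prime[q [e [qP hq ->]]]; apply: prime_point_dim hq.
  split; last first.
    move=> [p [pP pS]]; apply: (pt_dim _ _ _ (pP 0%N isT) _ _ (pS 0%N isT) (pS 1%N isT)).
      by have [] := pP 1%N isT.
    by have [] := pP 2%N isT.
  have [q [e [Pq hq e0 qw]]] := nonunit_prime_factor w0 hw w1.
  have XE := prime_of q e Pq hq qw.
  have [t lt] := plane_curve_point r hq e0.
  exists (fun i => if i == 0%N then extension r [set x | divides q x] else kernel t).
  split=> [[|[|//]] _ | [|//] _] //=.
  split; first exact: kernel_point.
  by move=> F XF; case: lt => + _; apply; case: XE => _; apply.
move=> p [P [f pf]].
have Xp : X `<=` p.
  by move=> F XF; rewrite pf => G [y ->]; rewrite mulrC; case: iX => _ _; apply.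
have ph : p h by apply: point_h.
split=> // q' [Q Xq] qp; apply/seteqP; split=> //.
(* For a closed point p = X : f, unmixedness would put f in X and thus 1 in p. In the remaining case
   p comes from a prime element, below which no other point of X fits. *)
have [pair | z | [q [qP qE]]] := point_cases r P ph.
- have [hp [ip p1 _] _] := P; case: p1.
  have pfE G : p G <-> X (G * f).
    rewrite pf; split=> [/(_ f)|XG K [y ->]].
      by apply; exists 1; rewrite mul1r.
    by rewrite mulrCA; case: iX => _ _; apply.
  apply/pfE; rewrite mul1r.
  apply: (uX _ (trace_homogeneous r hp) pair); first exact/pfE.
  by move=> x /pfE.
- by move: w0; rewrite (z w) ?eqxx //; apply: point_w.
have qh : q' h by apply: point_h.
have [[a [b [qa qb cop]]] | z | [q2 [q2P q2E]]] := point_cases r Q qh.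
- have [_ q1 _] := qP; case: q1.
  by apply: (coprime_common cop); apply/qE/qp.
- by move: w0; rewrite (z w) ?eqxx //; apply: point_w.
have [[_ [ip _ _] _] [_ [iq _ _] _]] := (P, Q).
move=> F /(ideal_mod_h rker F ip ph)/qE qF; apply/(ideal_mod_h rker F iq qh)/q2E.
apply: divides_trans qF; apply: prime_elt_divides => //; first by case: qP.
by apply/qE/qp/q2E/divides_refl.
Qed.

(** Without a coprime pair the trace has a nonunit common divisor; a prime factor of it is a curve
    in Z, and that curve with one of its points is a chain of length one. *)
Lemma zero_dimensional_trace Z : zero_dimensional Z -> Z h ->
  has_coprime_pair [set x | Z (s x)].
Proof.
move=> [[hZ _] ndim] Zh; have [iZ _] := hZ; have hT := trace_homogeneous r hZ.
apply: contrapT => N.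
have dim1 q e : ~ divides q 1 -> q != 0 -> q \is e.-homog ->
    (forall x, Z (s x) -> divides q x) -> False.
  move=> q1 q0 hq Zq.
  have [q' [e' [Pq hq' e0 qq']]] := nonunit_prime_factor q0 hq q1.
  have [t lt] := plane_curve_point r hq' e0.
  have ZE : Z `<=` extension r [set x | divides q' x].
    by move=> F /(ideal_mod_h rker F iZ Zh)/Zq; apply: divides_trans.
  apply: ndim; exists (fun i => if i == 0%N then extension r [set x | divides q' x] else kernel t).
  split=> [[|[|//]] _ | [|//] _] //=; first by split=> //; apply: prime_point hq'.
  split; first exact: kernel_point.
  by move=> F ZF; case: lt => + _; apply; apply: ZE.
(* If the trace is zero, any line in H serves as the curve; ['X_ord0] is one. *)
have [[x [Zx x0]]|N0] := pselect (exists x, Z (s x) /\ x != 0); last first.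
  apply: (dim1 'X_ord0 1%N) (mpolyX_neq0 k _) (homog_mpolyX k _) _.
    by move/(homog_unit (homog_mpolyX k _)).
  move=> x Zx; have [->|x0] := eqVneq x 0; first exact: divides0.
  by case: N0; exists x.
have [d [Zd xd0]] := homog_component hT Zx x0.
have [g [a [b [cop Za Zb Zg]]]] := ideal_common_divisor (proj1 hT) Zx x0.
have [e [hg _]] := homog_divides xd0 (pihomogP _ _ _) (Zg _ Zd).
apply: (dim1 g e) => //; last exact: divides_neq0 (Zg _ Zd) xd0.
move=> [u Eu]; apply: N; exists a, b; split=> //=.
  rewrite -[a]mulr1 Eu mulrCA rmorphM; case: iZ => _ _; exact.
rewrite -[b]mulr1 Eu mulrCA rmorphM; case: iZ => _ _; exact.
Qed.

Lemma coprime_pair_dim0 Z : Z h -> has_coprime_pair [set x | Z (s x)] -> ~ dim_ge Z 1.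
Proof.
move=> Zh [a [b [Za Zb cop]]] [p [pP pS]].
have [[P0 Z0] [P1 Z1]] := (pP 0%N isT, pP 1%N isT).
have [|t Et] := pair_point rker P0 (Z0 _ Zh).
  by exists a, b; split=> //; apply: Z0.
have [le ne] := pS 0%N isT; apply: ne.
by move: le; rewrite Et => /(kernel_maximal P1) ->.
Qed.

End UnmixedIdeals.

(** * Triples *)

Section PlaneTranslation.
Variables (k : closedFieldType) (h : {mpoly k[4]}) (r : retraction k 4 3).
Hypothesis h_linear : h \is 1.-homog.
Hypothesis rker : forall F, r F = 0 <-> divides h F.
Notation s := (lft r).
Notation ext := (extension r).
Notation "<( g )>" := [set x | divides g x].
Implicit Types (X : set {mpoly k[4]}) (J : set {mpoly k[3]}).

Lemma extension_ideal J : is_ideal J -> is_ideal (ext J).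
Proof.
move=> [J0 JD JM]; split=> [|f g|f g]; rewrite /extension /= ?rmorph0 //.
  by rewrite rmorphD; apply: JD.
by rewrite rmorphM; apply: JM.
Qed.

Lemma extension_inj J J' : ext J = ext J' -> J = J'.
Proof.
move=> E; have extE K x : K x = ext K (s x) by rewrite /extension /= lftK.
by apply/funext => x; rewrite extE E -extE.
Qed.

Lemma principal_ideal n (g : {mpoly k[n]}) : is_ideal <(g)>.
Proof. by split=> *; [apply: divides0 | apply: dividesD | apply: divides_mull]. Qed.

(** The maps [r] and [s] send variables to linear forms rather than to variables, so
    [saturation_linear_form] is needed in both directions. *)
Lemma saturation_extension J : is_ideal J -> saturation (ext J) = ext (saturation J).
Proof.
move=> iJ; have iE := extension_ideal iJ; apply/seteqP; split=> F satF i.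
  have [N EN] := saturation_linear_form iE satF (lft_homog r (homog_mpolyX k i)).
  by exists N; move: EN; rewrite /extension /= rmorphM rmorphXn lftK.
have [N JN] := saturation_linear_form iJ satF (red_homog r (homog_mpolyX k i)).
by exists N; rewrite /extension /= rmorphM rmorphXn.
Qed.

Lemma ideal_sumC n (I J : set {mpoly k[n]}) : ideal_sum I J = ideal_sum J I.
Proof.
by apply/seteqP; split=> _ [a [b [Ia Jb ->]]]; exists b, a; rewrite addrC.
Qed.

Lemma ideal_sum_plane X : ideal_sum X (principal h) = ext [set a | exists F, X F /\ r F = a].
Proof.
apply/seteqP; split=> [_ [a [_ [Xa [y ->] ->]]] | F [G [XG E]]].
  exists a; split=> //; rewrite rmorphD rmorphM (red_h rker) mulr0 addr0 //.
exists G, (F - G); split=> //; last by rewrite addrC subrK.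
by apply/rker; rewrite rmorphB E subrr.
Qed.

Lemma principal_saturated (g : {mpoly k[3]}) : saturation <(g)> = <(g)>.
Proof.
apply/seteqP; split=> x.
  move=> sx; have [[N gN] [M gM]] := (sx ord0, sx ord_max).
  have cop := @coprime_variables k 3 ord0 ord_max N M isT.
  exact: (cop g x gN gM).
by move=> gx i; exists 0%N; rewrite mul1r.
Qed.

Lemma cap_plane_principal F : scheme_cap (plane h) (principal F) = ext <(r F)>.
Proof.
rewrite /scheme_cap ideal_sumC ideal_sum_plane -principal_saturated -saturation_extension.
  congr (saturation (ext _)); apply/seteqP; split=> x.
    by move=> [G [[y ->] <-]]; rewrite rmorphM; apply/divides_mull/divides_refl.
  move=> [y ->]; exists (s y * F); split; last by rewrite rmorphM lftK.
  by exists (s y).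
exact: principal_ideal.
Qed.

Lemma effective_divisorP P : effective_divisor (plane h) P <->
  exists d (g : {mpoly k[3]}), [/\ g \is d.-homog, g != 0 & P = ext <(g)>].
Proof.
split=> [[d [f [hf nf ->]]] | [d [g [hg g0 ->]]]].
  exists d, (r f); split; [exact: red_homog | | exact: cap_plane_principal].
  by apply/eqP => /rker.
exists d, (s g); split; first exact: lft_homog.
  by move/rker => /eqP; rewrite lftK (negbTE g0).
by rewrite cap_plane_principal lftK.
Qed.

(** Since J and (g) are both saturated, so is J g; the ideal sheaf I_Z(-P) therefore has the plain
    product as its saturated ideal. *)
Lemma add_divisor_principal J g : is_ideal J -> saturation J = J -> g != 0 ->
  add_divisor (plane h) (ext J) (ext <(g)>) = ext [set y | exists2 x, J x & y = x * g].
Proof.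
move=> [J0 JD JM] satJ g0.
have iG : is_ideal [set y | exists2 x, J x & y = x * g].
  split=> [|_ _ [x Jx ->] [y Jy ->]|c _ [x Jx ->]].
  - by exists 0; rewrite ?mul0r.
  - by exists (x + y); [apply: JD | rewrite mulrDl].
  - by exists (c * x); [apply: JM | rewrite mulrA].
have satG : saturation [set y | exists2 x, J x & y = x * g] =
    [set y | exists2 x, J x & y = x * g].
  apply/seteqP; split=> y; last by move=> Gy i; exists 0%N; rewrite mul1r.
  move=> sy; have [c Ec] : <(g)> y.
    rewrite -principal_saturated => i; have [N [x Jx Ex]] := sy i.
    by exists N; exists x.
  exists c => //; rewrite -satJ => i; have [N [x Jx]] := sy i.
  by rewrite Ec mulrA => /(mulIf g0) E; exists N; rewrite E.
rewrite /add_divisor ideal_sum_plane -[in RHS]satG -saturation_extension //.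
congr (saturation (ext _)); apply/seteqP; split=> [a | _ [x Jx ->]].
  move=> [_ [[t [tP ->]] <-]]; case: iG => G0 GD GM; rewrite raddf_sum big_seq.
  elim/big_rec: _ => // -[u v] y /tP [/= Ju [c Ec]] Gy; apply: GD => //.
  by exists (c * r u); [apply: JM | rewrite rmorphM Ec; ring].
exists (s x * s g); split; last by rewrite rmorphM !lftK.
exists [:: (s x, s g)]; split; last by rewrite big_seq1.
move=> u; rewrite inE => /eqP -> /=; split; rewrite /extension /= lftK //.
exact: divides_refl.
Qed.

(** Membership of a pair in X, viewed in the dual numbers over A. *)
Definition dual X a b := X (s a + h * s b).

Lemma dual_split X F : is_ideal X -> X (h * h) ->
  exists b, F = s (r F) + h * b /\ (X F <-> dual X (r F) (r b)).
Proof.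
move=> iX Xhh; have [X0 XD XM] := iX; have [b Eb] := lft_mod_h rker F.
have EF : F = s (r F) + h * b by rewrite [h * b]mulrC -Eb addrC subrK.
exists b; split=> //; have [c Ec] := lft_mod_h rker b.
have Xd : X (h * b - h * s (r b)).
  by rewrite -mulrBr Ec mulrCA; apply: XM.
rewrite /dual {1}EF; split=> XF.
  have -> : s (r F) + h * s (r b) = s (r F) + h * b - (h * b - h * s (r b)) by ring.
  exact: idealB.
have -> : s (r F) + h * b = s (r F) + h * s (r b) + (h * b - h * s (r b)) by ring.
exact: XD.
Qed.

Lemma dual_h X F : is_ideal X -> X (h * h) -> X (h * F) <-> dual X 0 (r F).
Proof.
move=> iX Xhh; have [X0 XD XM] := iX; have [c Ec] := lft_mod_h rker F.
have Xd : X (h * F - h * s (r F)) by rewrite -mulrBr Ec mulrCA; apply: XM.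
rewrite /dual rmorph0 add0r; split=> XF.
  by rewrite -(subKr (h * F) (h * _)); apply: idealB.
by rewrite -[h * F](subrK (h * s (r F))); apply: XD.
Qed.

Lemma residual_plane X : is_ideal X -> X (h * h) ->
  residual X (plane h) = ext [set b | dual X 0 b].
Proof.
move=> iX Xhh; have [X0 XD XM] := iX; apply/seteqP; split=> F.
  move=> XF; apply/dual_h => //; rewrite mulrC; apply: XF.
  by exists 1; rewrite mul1r.
move=> /(dual_h F iX Xhh) XF G [y ->].
by rewrite mulrCA [F * h]mulrC; apply: XM.
Qed.

End PlaneTranslation.

(** * Powers of variables as a regular sequence *)

Section MonomialIdeal.
Variables (k : fieldType) (n : nat).
Implicit Types p q c : {mpoly k[n]}.

Lemma mcoeff_mulXn_small p (i : 'I_n) N (m : 'X_{1..n}) :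
  (m i < N)%N -> (p * 'X_i ^+ N)@_m = 0.
Proof.
move=> lt; apply: memN_msupp_eq0; rewrite mpolyXn (perm_mem (msuppMX _ _)).
apply/negP => /mapP[m' _ Em]; move: lt; rewrite Em mnmDE mulmnE mnm1E eqxx mul1n.
by rewrite ltnNge leq_addr.
Qed.

(** Monomial by monomial: a monomial of c with small exponents in x_i and x_j keeps them after
    multiplication by x_l^L, and the right-hand side has no such monomial. *)
Lemma regular_variable (i j l : 'I_n) N M L c p q : i != l -> j != l ->
  c * 'X_l ^+ L = p * 'X_i ^+ N + q * 'X_j ^+ M ->
  exists p' q', c = p' * 'X_i ^+ N + q' * 'X_j ^+ M.
Proof.
move=> il jl E; rewrite [c]mpolyE big_seq.
elim/big_rec: _ => [|m x mc [p1 [q1 ->]]]; first by exists 0, 0; rewrite !mul0r addr0.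
have split_expX v K : (K <= m v)%N -> exists y : {mpoly k[n]}, 'X_[m] = y * 'X_v ^+ K.
  move=> le; exists 'X_[m - U_(v) *+ K]; rewrite mpolyXn -mpolyXD; congr 'X_[_].
  rewrite submK //; apply/mnm_lepP => w; rewrite mulmnE mnm1E.
  by case: eqP => [<-|_]; rewrite ?mul1n ?mul0n.
have [/split_expX[y ->]|ltN] := leqP N (m i).
  by exists (c@_m *: y + p1), q1; rewrite mulrDl -scalerAl; ring.
have [/split_expX[y ->]|ltM] := leqP M (m j).
  by exists p1, (c@_m *: y + q1); rewrite mulrDl -scalerAl; ring.
move: mc; rewrite mcoeff_msupp; case/eqP.
have := congr1 (fun x => x@_((U_(l) *+ L) + m)%MM) E.
rewrite /= {1}mpolyXn mcoeffMX mcoeffD => ->.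
rewrite !mcoeff_mulXn_small ?addr0 // mnmDE mulmnE mnm1E eq_sym.
  by rewrite (negbTE jl) mul0n add0n.
by rewrite (negbTE il) mul0n add0n.
Qed.

End MonomialIdeal.

(** * First and second components of an ideal containing h^2 *)

Section TripleData.
Variables (k : closedFieldType) (h : {mpoly k[4]}) (r : retraction k 4 3).
Hypothesis h_linear : h \is 1.-homog.
Hypothesis rker : forall F, r F = 0 <-> divides h F.
Notation s := (lft r).
Notation ext := (extension r).
Notation "<( g )>" := [set x | divides g x].
Notation dual := (dual h r).
Notation unmixed := (unmixed h r).
Implicit Types (X : set {mpoly k[4]}) (Z J : set {mpoly k[3]}).

(** By [imageE] this is the image of X in A, the ideal of the intersection with H before
    saturation. *)
Definition image X : set {mpoly k[3]} := [set a | exists b, dual X a b].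

(** What the computation uses of a curve in 2H, in a form that the unit ideal satisfies too, so that
    empty C and D are covered. The last clause says that X does not contain H. *)
Definition generically_plane X :=
  [/\ homogeneous_ideal X, X (h * h), unmixed X & exists F, X F /\ r F != 0].

Lemma imageE X : is_ideal X -> X (h * h) -> image X = [set a | exists F, X F /\ r F = a].
Proof.
move=> iX Xhh; apply/seteqP; split=> a [b].
  move=> Xab; exists (s a + h * s b); split=> //.
  by rewrite rmorphD rmorphM (red_h rker) mul0r addr0 lftK.
move=> [Xb <-]; have [c [_ [XF _]]] := dual_split rker b iX Xhh.
by exists (r c); apply: XF.
Qed.

Lemma dualD X a b a' b' : is_ideal X -> dual X a b -> dual X a' b' -> dual X (a + a') (b + b').
Proof.
move=> [_ XD _]; rewrite /dual => Xa Xb; have := XD _ _ Xa Xb.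
by rewrite !rmorphD; congr (X _); ring.
Qed.

Lemma dualM X c a b : is_ideal X -> dual X a b -> dual X (c * a) (c * b).
Proof.
move=> [_ _ XM]; rewrite /dual => Xa; have := XM (s c) _ Xa.
by rewrite !rmorphM; congr (X _); ring.
Qed.

Lemma dualB X a b a' b' : is_ideal X -> dual X a b -> dual X a' b' -> dual X (a - a') (b - b').
Proof.
move=> iX Xa Xb; rewrite -mulN1r -[- b']mulN1r; apply: dualD => //; exact: dualM.
Qed.

Lemma dual_shift X a b : is_ideal X -> X (h * h) -> dual X a b -> dual X 0 a.
Proof.
move=> iX Xhh; have [X0 XD XM] := iX; rewrite /dual rmorph0 add0r => Xa.
have -> : h * s a = h * (s a + h * s b) - s b * (h * h) by ring.
by apply: idealB => //; apply: (XM).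
Qed.

Lemma image_shift X a : is_ideal X -> X (h * h) -> image X a -> dual X 0 a.
Proof. by move=> iX Xhh [b]; apply: dual_shift. Qed.

Lemma image_homogeneous X : homogeneous_ideal X -> X (h * h) -> homogeneous_ideal (image X).
Proof.
move=> hX Xhh; have [iX hpi] := hX; have [X0 XD XM] := iX.
split; first split=> [|a a' [b Xa] [b' Xa']|c a [b Xa]].
- by exists 0; rewrite /dual rmorph0 mulr0 addr0.
- by exists (b + b'); apply: dualD.
- by exists (c * b); apply: dualM.
rewrite imageE // => a d [F [XF <-]]; exists (pihomog mdeg d F); split; first exact: hpi.
by rewrite (graded_pihomog (@red_homog _ _ _ r)).
Qed.

Lemma dual0_homogeneous X : homogeneous_ideal X -> homogeneous_ideal [set b | dual X 0 b].
Proof.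
move=> hX; have := trace_homogeneous r (homogeneous_colon h_linear hX).
congr homogeneous_ideal; apply/funext => b; rewrite /dual /= rmorph0 add0r mulrC //.
Qed.

(** The second components b with (0, b) in X have a common divisor g, and the elements carrying g
    into them include a coprime pair. Unmixedness then puts h g itself in X: the residual Y is a
    divisor. *)
Lemma dual0_principal X : generically_plane X ->
  exists g, g != 0 /\ forall b, dual X 0 b <-> divides g b.
Proof.
move=> [hX Xhh uX [F [XF rF0]]]; have [iX _] := hX.
have [iJ hJ] := dual0_homogeneous hX.
have J1 : dual X 0 (r F) by apply: image_shift => //; rewrite imageE //; exists F.
have [g [a [b [cop Xa Xb Xg]]]] := ideal_common_divisor iJ J1 rF0.
have g0 : g != 0 := divides_neq0 (Xg _ J1) rF0.
have [d [Jd fd0]] := homog_component (conj iJ hJ) J1 rF0.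
have [e [hg _]] := homog_divides fd0 (pihomogP _ _ _) (Xg _ Jd).
have hS : homogeneous_ideal [set x | dual X 0 (x * g)].
  exact: (homogeneous_colon hg (conj iJ hJ)).
exists g; split=> // c; split=> [/Xg //|[u ->]].
suff : dual X 0 g by case: (iJ) => _ _; apply.
rewrite /dual rmorph0 add0r.
have [X0 XD XM] := iX.
apply: (uX _ hS); first by exists a, b.
  by rewrite mulrA mulrC; apply: XM.
by move=> x; rewrite /dual /= rmorph0 add0r rmorphM mulrCA.
Qed.

(* Vanishing of the first cohomology of the ideal of a plane curve: the local
   obstruction to a common b in dual X a b is a Koszul cycle. *)
Lemma image_saturated X : generically_plane X -> saturation (image X) = image X.
Proof.
move=> gX; have [g [g0 gE]] := dual0_principal gX; have [hX Xhh uX _] := gX.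
have [iX _] := hX; have [X0 XD XM] := iX.
apply/seteqP; split=> a; last by move=> Xa i; exists 0%N; rewrite mul1r.
move=> sa; pose i0 : 'I_3 := ord0; pose i2 : 'I_3 := ord_max; pose i1 : 'I_3 := Ordinal (isT : (1 < 3)%N).
have [N [b1 E1]] := sa i0; have [M [b2 E2]] := sa i1; have [L [b3 E3]] := sa i2.
set x := 'X_i0 ^+ N in E1; set y := 'X_i1 ^+ M in E2; set z := 'X_i2 ^+ L in E3.
have cop : coprime_elts x y by apply: coprime_variables.
have cyc (v w c d : {mpoly k[3]}) : dual X (v * a) c -> dual X (w * a) d -> divides g (w * c - v * d).
  move=> Xv Xw; apply/gE; rewrite -(subrr (w * (v * a))) {2}mulrCA.
  by apply: dualB => //; apply: dualM.
have [c12 E12] := cyc _ _ _ _ E1 E2.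
have [c13 E13] := cyc _ _ _ _ E1 E3.
have [c23 E23] := cyc _ _ _ _ E2 E3.
have Ec : c12 * z = - c23 * x + c13 * y.
  apply: (mulIf g0); transitivity (z * (c12 * g)); first by ring.
  transitivity (y * (c13 * g) - x * (c23 * g)); last by ring.
  by rewrite -E12 -E13 -E23; ring.
(* With c12 = p x + q y, replacing b1 by b1 - q g and b2 by b2 + p g turns the congruence y b1 = x
   b2 modulo g into an equality; coprimality of x and y yields the common b. *)
have [||p [q Epq]] := regular_variable _ _ Ec; try by [].
have Eb : y * (b1 - q * g) = x * (b2 + p * g).
  apply/eqP; rewrite -subr_eq0; apply/eqP.
  transitivity ((y * b1 - x * b2) - (p * x + q * y) * g); first by ring.
  by rewrite E12 Epq subrr.
have x0 : x != 0 by apply/expf_neq0/mpolyX_neq0.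
have [b Exb] : divides x (b1 - q * g).
  apply: (coprime_gauss cop); rewrite Eb; apply/divides_mulr/divides_refl.
have Eyb : b2 + p * g = b * y.
  by apply: (mulfI x0); rewrite -Eb Exb; ring.
have Dg c : dual X 0 (c * g) by apply/gE/divides_mull/divides_refl.
have Xx : dual X (x * a) (x * b).
  have := dualB iX E1 (Dg q); rewrite subr0 Exb; congr (dual X _ _); exact: mulrC.
have Xy : dual X (y * a) (y * b).
  have := dualD iX E2 (Dg p); rewrite addr0 Eyb; congr (dual X _ _); exact: mulrC.
have Xa0 : dual X 0 a.
  by apply/gE; apply: cop; apply/gE; [apply: dual_shift Xx | apply: dual_shift Xy].
exists b; rewrite /dual.
have hexp (i : 'I_3) K : ('X_i : {mpoly k[3]}) ^+ K \is (1 * K).-homog.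
  exact/dhomogMn/homog_mpolyX.
apply: (unmixed_pair iX uX (hexp i0 N) (hexp i1 M) cop).
- move: Xa0; rewrite /dual rmorph0 add0r => Xa0.
  have -> : h * (s a + h * s b) = h * s a + s b * (h * h) by ring.
  by apply: XD => //; apply: XM.
- by move: Xx; rewrite /dual !rmorphM -/x; congr (X _); ring.
- by move: Xy; rewrite /dual !rmorphM -/y; congr (X _); ring.
Qed.

End TripleData.

(** * Equations of a triple *)

Section Linkage.
Variables (k : closedFieldType) (h : {mpoly k[4]}) (r : retraction k 4 3).
Hypothesis h_linear : h \is 1.-homog.
Hypothesis h_neq0 : h != 0.
Hypothesis rker : forall F, r F = 0 <-> divides h F.
Notation s := (lft r).
Notation ext := (extension r).
Notation "<( g )>" := [set x | divides g x].
Notation dual := (dual h r).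
Notation image := (image h r).
Notation unmixed := (unmixed h r).
Notation generically_plane := (generically_plane h r).
Implicit Types (C D X : set {mpoly k[4]}) (Z J : set {mpoly k[3]}).

(* The triple of X is {extension Z, extension (g), extension (f)}, and e is the
   equation of P - Y. *)
Definition triple_data X Z (f g e : {mpoly k[3]}) :=
  [/\ [/\ homogeneous_ideal Z, saturation Z = Z & has_coprime_pair Z],
      [/\ f != 0, f = g * e & exists d, f \is d.-homog],
      forall b, dual X 0 b <-> divides g b
    & forall a, image X a <-> exists2 z, Z z & a = z * f].

(** Z is the colon of the first components by their common divisor f, and inherits saturation from
    them. Multiplication by h moves first components into (g), so g divides a f and b f for coprime
    a, b, hence f. *)
Lemma triple_data_exists X : generically_plane X -> exists Z f g e, triple_data X Z f g e.
Proof.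
move=> gX; have [hX Xhh uX [F [XF rF0]]] := gX; have [iX _] := hX.
have hJ := image_homogeneous rker hX Xhh; have [iJ _] := hJ; have [J0 JD JM] := iJ.
have J1 : image X (r F) by rewrite imageE //; exists F.
have [f [a [b [cop Ja Jb Jf]]]] := ideal_common_divisor iJ J1 rF0.
have f0 : f != 0 := divides_neq0 (Jf _ J1) rF0.
have [d [Jd fd0]] := homog_component hJ J1 rF0.
have [e [hf _]] := homog_divides fd0 (pihomogP _ _ _) (Jf _ Jd).
have [g [g0 gE]] := dual0_principal h_linear rker gX.
have [u Eu] : divides g f.
  by apply: (cop g f); apply/gE; apply: image_shift.
exists [set z | image X (z * f)], f, g, u; split=> //.
- split; [exact: homogeneous_colon hf hJ | | by exists a, b].
  apply/seteqP; split=> z /= sz; last by move=> i; exists 0%N; rewrite mul1r.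
  rewrite -(image_saturated h_linear rker gX) => i; have [N XN] := sz i.
  by exists N; rewrite mulrA.
- by split=> //; [rewrite Eu mulrC | exists e].
- move=> c; split=> [Jc | [z Jz ->] //].
  by have [z Ez] := Jf _ Jc; exists z; rewrite /= -?Ez.
Qed.

(** A coprime pair in Z makes f the greatest common divisor of the first components. Equations are
    unique only up to units, so principal ideals are compared. *)
Lemma triple_data_unique X Z f g e Z' f' g' e' :
  triple_data X Z f g e -> triple_data X Z' f' g' e' ->
  [/\ Z = Z', <(f)> = <(f')>, <(g)> = <(g')> & <(e)> = <(e')>].
Proof.
have le Z1 f1 g1 e1 Z2 f2 g2 e2 : triple_data X Z1 f1 g1 e1 -> triple_data X Z2 f2 g2 e2 ->
    divides f1 f2 /\ divides g1 g2.
  move=> [_ _ g1E f1E] [[_ _ [a [b [Za Zb cop]]]] _ g2E f2E]; split; last first.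
    by apply/g1E/g2E/divides_refl.
  have f1Z z : Z2 z -> divides f1 (z * f2).
    by move=> Zz; have [|y _ ->] := (f1E (z * f2)).1; [apply/f2E; exists z | exists y].
  by apply: cop; apply: f1Z.
have eqd n (x y : {mpoly k[n]}) : divides x y -> divides y x -> <(x)> = <(y)>.
  by move=> xy yx; apply/seteqP; split=> z; apply: divides_trans.
move=> T T'; have [[ff' gg'] [f'f g'g]] := (le _ _ _ _ _ _ _ _ T T', le _ _ _ _ _ _ _ _ T' T).
have [[[iZ _] _ _] [f0 Ef _] _ fE] := T; have [[[iZ' _] _ _] [f'0 Ef' _] _ f'E] := T'.
have leZ Z1 Z2 f1 f2 : is_ideal Z1 -> f2 != 0 -> divides f1 f2 ->
    (forall a, image X a <-> exists2 z, Z1 z & a = z * f1) ->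
    (forall a, image X a <-> exists2 z, Z2 z & a = z * f2) -> Z1 `<=` Z2.
  move=> iZ1 f20 [u Eu] E1 E2 z Zz; have [|z' Zz' /(mulIf f20) ->] // := (E2 (z * f2)).1.
  by apply/E1; exists (u * z); [case: iZ1 => _ _; apply | rewrite Eu; ring].
have lee (g1 e1 g2 e2 : {mpoly k[3]}) : g1 != 0 -> divides g2 g1 -> divides (g1 * e1) (g2 * e2) -> divides e1 e2.
  move=> g10 g21 d; apply: (divides_cancel g10); rewrite [e1 * _]mulrC.
  by apply: divides_trans d _; rewrite [e2 * _]mulrC; apply: divides_mul (divides_refl _).
have [g0 g'0] : g != 0 /\ g' != 0.
  by split; [apply: contraNneq f0 | apply: contraNneq f'0] => z; rewrite ?Ef ?Ef' z mul0r.
split; try exact: eqd.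
  apply/seteqP; split; first exact: leZ f'0 ff' fE f'E.
  exact: leZ f0 f'f f'E fE.
by apply: eqd; [apply: (lee g _ g') | apply: (lee g' _ g)] => //; rewrite -Ef -Ef'.
Qed.

Lemma triple_data_image X Z f g e : triple_data X Z f g e ->
  image X = [set y | exists2 x, Z x & y = x * f].
Proof. by move=> [_ _ _ fE]; apply/seteqP; split=> a /fE. Qed.

Lemma cap_plane X : homogeneous_ideal X -> X (h * h) ->
  scheme_cap X (plane h) = ext (saturation (image X)).
Proof.
move=> hX Xhh; have [iX _] := hX; have [iJ _] := image_homogeneous rker hX Xhh.
by rewrite /scheme_cap (ideal_sum_plane rker) -(imageE rker iX Xhh) saturation_extension.
Qed.

Lemma zero_dimensional_extension Z : homogeneous_ideal Z -> saturation Z = Z ->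
  has_coprime_pair Z -> zero_dimensional (ext Z) /\ subscheme (ext Z) (plane h).
Proof.
move=> hZ satZ pair; have [iZ _] := hZ; split; first split.
- split; first exact: extension_homogeneous.
  by rewrite saturation_extension // satZ.
- apply: (coprime_pair_dim0 rker).
    by rewrite /extension /= (red_h rker); case: iZ.
  by case: pair => a [b [Za Zb cop]]; exists a, b; rewrite /extension /= !lftK.
by move=> F [y ->]; rewrite /extension /= rmorphM (red_h rker) mulr0; case: iZ.
Qed.

Lemma zero_dimensional_in_plane W : zero_dimensional W -> subscheme W (plane h) ->
  exists Z, [/\ W = ext Z, homogeneous_ideal Z, saturation Z = Z & has_coprime_pair Z].
Proof.
move=> Wz Wsub; have [[hW satW] _] := Wz; have [iW _] := hW.
have Wh : W h by apply: Wsub; exists 1; rewrite mul1r.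
have WE : W = ext [set x | W (s x)].
  by apply/seteqP; split=> F /(ideal_mod_h rker F iW Wh).
have hT := trace_homogeneous r hW.
exists [set x | W (s x)]; split=> //; last exact: zero_dimensional_trace rker _ Wz Wh.
by apply: (@extension_inj _ r); rewrite -saturation_extension -?WE //; case: hT.
Qed.

Lemma triple_data_of_triple X W Y P : generically_plane X -> has_triple h X W Y P ->
  exists Z f g e, [/\ triple_data X Z f g e, W = ext Z, Y = ext <(g)> & P = ext <(f)>].
Proof.
move=> gX [[Wz Wsub] effP capE YE]; have [hX Xhh uX _] := gX; have [iX _] := hX.
have [Z [WE hZ satZ pair]] := zero_dimensional_in_plane Wz Wsub.
have [d [f [hf f0 PE]]] := (effective_divisorP rker P).1 effP.
have [g [g0 gE]] := dual0_principal h_linear rker gX.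
have [iZ _] := hZ.
move: capE; rewrite cap_plane // (image_saturated h_linear rker gX) WE PE.
rewrite (add_divisor_principal rker) // => /(@extension_inj _ r) imE.
have fE a : image X a <-> exists2 z, Z z & a = z * f by rewrite imE.
have [e Ee] : divides g f.
  have [a [b [Za Zb cop]]] := pair.
  by apply: cop; apply/gE; apply: (image_shift iX Xhh); apply/fE; [exists a | exists b].
exists Z, f, g, e; split=> //.
  by split=> //; split=> //; [rewrite Ee mulrC | exists d].
rewrite YE (residual_plane rker) //; congr (ext _).
by apply/seteqP; split=> b /gE.
Qed.

Lemma triple_of_triple_data X Z f g e : generically_plane X -> triple_data X Z f g e ->
  has_triple h X (ext Z) (ext <(g)>) (ext <(f)>).
Proof.
move=> gX T; have [hX Xhh uX _] := gX; have [iX _] := hX.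
have [[hZ satZ pair] [f0 Ef [d hf]] gE fE] := T; have [iZ _] := hZ.
split.
- exact: zero_dimensional_extension.
- by apply/(effective_divisorP rker); exists d, f.
- rewrite cap_plane // (image_saturated h_linear rker gX) (add_divisor_principal rker) //.
  by rewrite (triple_data_image T).
- rewrite (residual_plane rker) //; congr (ext _).
  by apply/seteqP; split=> b /gE.
Qed.

Lemma curve_or_empty_generically_plane X : curve_or_empty X ->
  subscheme X (double_plane h) -> generically_plane X.
Proof.
move=> cX sX; have Xhh : X (h * h) by apply: sX; exists 1; rewrite mul1r expr2.
case: cX => [cX | ->].
  split=> //; [by case: cX => -[] | exact: curve_unmixed | exact: curve_not_plane cX].
split=> //; exists 1; split=> //; by rewrite rmorph1 oner_neq0.
Qed.

End Linkage.

(** * Linkage *)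

Section LinkedIdeal.
Variables (k : closedFieldType) (h : {mpoly k[4]}) (r : retraction k 4 3).
Hypothesis h_linear : h \is 1.-homog.
Hypothesis h_neq0 : h != 0.
Hypothesis rker : forall F, r F = 0 <-> divides h F.
Notation s := (lft r).
Notation ext := (extension r).
Notation "<( g )>" := [set x | divides g x].
Notation dual := (dual h r).
Notation image := (image h r).
Notation unmixed := (unmixed h r).
Notation generically_plane := (generically_plane h r).
Notation triple_data := (triple_data h r).

Variables (s0 : {mpoly k[4]}) (d0 : nat).
Hypothesis s0_homog : s0 \is d0.-homog.
Notation q := (r s0).
Hypothesis q_neq0 : q != 0.
Notation E := (ideal_sum (double_plane h) (principal s0)).

Lemma complete_intersection_ideal : is_ideal E.
Proof.
split=> [|_ _ [_ [_ [[x ->] [y ->] ->]]] [_ [_ [[x' ->] [y' ->] ->]]]|c _ [_ [_ [[x ->] [y ->] ->]]]].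
- by exists 0, 0; split; [exists 0 | exists 0 | ]; rewrite ?mul0r ?addr0.
- exists ((x + x') * h ^+ 2), ((y + y') * s0).
  by split; [exists (x + x') | exists (y + y') | ring].
exists (c * x * h ^+ 2), (c * y * s0); by split; [exists (c * x) | exists (c * y) | ring].
Qed.

Lemma complete_intersection_hh : E (h * h).
Proof. by exists (1 * h ^+ 2), (0 * s0); split; [exists 1 | exists 0 | ring]. Qed.

Lemma complete_intersection_s0 : E s0.
Proof. by exists (0 * h ^+ 2), (1 * s0); split; [exists 0 | exists 1 | ring]. Qed.

Lemma complete_intersection_homogeneous : homogeneous_ideal E.
Proof.
split=> [|_ d [_ [_ [[x ->] [y ->] ->]]]]; first exact: complete_intersection_ideal.
have piM (c x' : {mpoly k[4]}) j : c \is j.-homog -> principal c (pihomog mdeg d (x' * c)).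
  move=> hc; have [lt | le] := ltnP d j.
    by exists 0; rewrite (pihomogMr_lt _ hc lt) mul0r.
  by exists (pihomog mdeg (d - j) x'); rewrite -(pihomogMr _ _ hc) subnK.
exists (pihomog mdeg d (x * h ^+ 2)), (pihomog mdeg d (y * s0)); split.
- exact/(piM _ _ (1 * 2)%N)/dhomogMn.
- exact: piM s0_homog.
- exact: raddfD.
Qed.

(** Modulo h^2, s0 is the pair (q, t), and its multiple by (x, y) is (q x, q y + t x). *)
Lemma complete_intersection_dual : exists t, dual E q t /\
  (forall X, is_ideal X -> X (h * h) -> X s0 <-> dual X q t) /\
  forall a b, dual E a b <-> exists x y, a = q * x /\ b = q * y + t * x.
Proof.
have iE := complete_intersection_ideal; have Ehh := complete_intersection_hh.
have [E0 ED EM] := iE.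
have [c Ec] := lft_mod_h rker s0.
have s0E : s0 = s q + h * c by rewrite [h * c]mulrC -Ec addrC subrK.
have [c' Ec'] := lft_mod_h rker c.
have XE X : is_ideal X -> X (h * h) -> X s0 <-> dual X q (r c).
  move=> iX Xhh; case: (iX) => X0 XD XM; rewrite /dual.
  have -> : s q + h * s (r c) = s0 - c' * (h * h).
    have hc : h * c = h * s (r c) + c' * (h * h).
      transitivity (h * (c - s (r c)) + h * s (r c)); first by ring.
      by rewrite Ec'; ring.
    by apply: (addIr (c' * (h * h))); rewrite subrK [RHS]s0E hc addrA.
  split=> Xs; first by apply: idealB => //; apply: (XM).
  by rewrite -[s0](subrK (c' * (h * h))); apply: XD => //; apply: XM.
have Eqt : dual E q (r c) by apply/(XE E iE Ehh); apply: complete_intersection_s0.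
exists (r c); split=> //; split=> // a b; split; last first.
  move=> [x [y [-> ->]]]; rewrite [X in dual _ _ X]addrC -[q * x]addr0.
  apply: dualD => //; first by rewrite [q * x]mulrC [r c * x]mulrC; apply: dualM.
  rewrite mulrC -[0](mulr0 y); apply: dualM => //.
  exact: (dual_shift iE Ehh Eqt).
move=> [_ [_ [[u ->] [v ->] Euv]]].
have Ea : a = r v * q.
  move: (congr1 r Euv); rewrite !rmorphD rmorphM [r (u * _)]rmorphM expr2 [r (h * h)]rmorphM.
  by rewrite (red_h rker) !mul0r mulr0 addr0 add0r lftK rmorphM.
have [v' Ev] := lft_mod_h rker v.
exists (r v), (r v'); split; first by rewrite Ea mulrC.
have Eb : h * (s b - v' * s q - s (r v) * c) = h * (h * (u + v' * c)).
  have vE : v = s (r v) + v' * h by rewrite -Ev addrC subrK.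
  have : h * s b = u * h ^+ 2 + v * s0 - s a by rewrite -Euv; ring.
  rewrite Ea rmorphM => E1; rewrite !mulrBr E1 {1}vE {1}s0E; ring.
(* One factor h cancels, and the one left on the right-hand side vanishes under [r]. *)
move/(mulfI h_neq0)/(congr1 r): Eb.
rewrite !rmorphM !rmorphB (red_h rker) mul0r !rmorphM !lftK => /eqP.
by rewrite subr_eq0 subr_eq => /eqP ->; ring.
Qed.

Lemma dual_red X a F : is_ideal X -> X (h * h) -> X (s a + h * F) <-> dual X a (r F).
Proof.
move=> iX Xhh; have [X0 XD XM] := iX; have [c Ec] := lft_mod_h rker F.
have hF : h * F = h * s (r F) + c * (h * h).
  transitivity (h * (F - s (r F)) + h * s (r F)); first by ring.
  by rewrite Ec; ring.
rewrite /dual hF addrA; split=> XF; last by apply: XD => //; apply: XM.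
by rewrite -[s a + _](addrK (c * (h * h))); apply: idealB => //; apply: XM.
Qed.

(** From h u in E the first component of u is q y. Then q divides z (e - t y) for every z in S,
    where e is the second component, and the coprime pair cancels z. *)
Lemma complete_intersection_unmixed : unmixed E.
Proof.
have iE := complete_intersection_ideal; have Ehh := complete_intersection_hh.
have [t [_ [_ tE]]] := complete_intersection_dual.
move=> S hS [a [b [Sa Sb cop]]] u Ehu ESu.
move/(dual_h rker u iE Ehh): Ehu => /tE[x [y [/esym/eqP + Ey]]].
rewrite mulf_eq0 (negbTE q_neq0) /= => /eqP x0; rewrite x0 mulr0 addr0 in Ey.
have [e [Eu uE]] := dual_split rker u iE Ehh; apply/uE.
have qd z : S z -> divides q (z * (r e - t * y)).
  move=> Sz; have : dual E (z * r u) (z * r e).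
    have := ESu z Sz; have -> : s z * u = s (z * r u) + h * (s z * e).
      by rewrite {1}Eu rmorphM; ring.
    by rewrite dual_red // rmorphM lftK.
  move=> /tE[x' [y' [Ex' Ey']]]; exists y'.
  have -> : z * (r e - t * y) = z * r e - t * (z * y) by ring.
  rewrite Ey'; have -> : z * y = x'; last by ring.
  by apply: (mulfI q_neq0); rewrite -Ex' Ey; ring.
have [y2 Ey2] := cop q (r e - t * y) (qd a Sa) (qd b Sb).
by apply/tE; exists y, y2; split; [rewrite Ey | rewrite [q * _]mulrC -Ey2 subrK].
Qed.

End LinkedIdeal.

(** * The residual of C in the complete intersection *)

Section LinkedTriple.
Variables (k : closedFieldType) (h : {mpoly k[4]}) (r : retraction k 4 3).
Hypothesis h_linear : h \is 1.-homog.
Hypothesis h_neq0 : h != 0.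
Hypothesis rker : forall F, r F = 0 <-> divides h F.
Notation s := (lft r).
Notation dual := (dual h r).
Notation image := (image h r).
Notation unmixed := (unmixed h r).
Notation generically_plane := (generically_plane h r).
Notation triple_data := (triple_data h r).

Variables (s0 : {mpoly k[4]}) (d0 : nat).
Hypothesis s0_homog : s0 \is d0.-homog.
Notation q := (r s0).
Hypothesis q_neq0 : q != 0.
Notation E := (ideal_sum (double_plane h) (principal s0)).

Variables (C : set {mpoly k[4]}) (Z : set {mpoly k[3]}) (f g e : {mpoly k[3]}).
Hypothesis C_plane : generically_plane C.
Hypothesis C_data : triple_data C Z f g e.
Hypothesis C_s0 : C s0.
Notation D := (ideal_colon E C).

Let iE : is_ideal E := complete_intersection_ideal h s0.
Let Ehh : E (h * h) := complete_intersection_hh h s0.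
Let iC : is_ideal C. Proof. by case: C_plane => -[]. Qed.
Let Chh : C (h * h). Proof. by case: C_plane. Qed.

Lemma linked_ideal : is_ideal D.
Proof.
have [E0 ED EM] := iE; split=> [G CG|F F' DF DF' G CG|c F DF G CG].
- by rewrite mul0r.
- by rewrite mulrDl; apply: ED; [apply: DF | apply: DF'].
- by rewrite -mulrA; apply: EM; apply: DF.
Qed.

Lemma linked_contains : E `<=` D.
Proof. by have [E0 ED EM] := iE; move=> F EF G CG; rewrite mulrC; apply: EM. Qed.

(** The colon inherits unmixedness from E: the condition for u is tested on the products u G with G
    in C. *)
Lemma linked_generically_plane : generically_plane D.
Proof.
have [E0 ED EM] := iE; have [[_ hC] _ _ _] := C_plane.
have [_ hE] := complete_intersection_homogeneous h_linear s0_homog.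
split.
- split=> [|F d DF G CG]; first exact: linked_ideal.
  rewrite (pihomog_partitionE (leqnn (msize G))) mulr_sumr.
  elim/big_rec: _ => // i x _ Ex; apply: ED => //.
  by rewrite -(pihomogMr _ _ (pihomogP mdeg i G)); apply/hE/DF/hC.
- by apply: linked_contains.
- move=> S hS pair u Dhu DSu G CG.
  apply: (complete_intersection_unmixed h_neq0 rker q_neq0 hS pair).
    by rewrite mulrA; apply: Dhu.
  by move=> x Sx; rewrite mulrA; apply: DSu.
- by exists s0; split=> //; apply/linked_contains/complete_intersection_s0.
Qed.

(** The right-hand pair is the product of (c, d) and (a, b) modulo h^2. *)
Lemma linked_dual c d : dual D c d <->
  forall a b, dual C a b -> dual E (c * a) (c * b + d * a).
Proof.
have [E0 ED EM] := iE.
have prod G y a : G = s a + h * y -> (s c + h * s d) * G =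
    s (c * a) + h * (s c * y + s d * s a) + s d * y * (h * h).
  by move=> ->; rewrite rmorphM; ring.
have Eprod G y a : G = s a + h * y ->
    E ((s c + h * s d) * G) <-> dual E (c * a) (c * r y + d * a).
  move=> EG; rewrite (prod _ _ _ EG).
  rewrite (_ : c * r y + d * a = r (s c * y + s d * s a)); last first.
    by rewrite rmorphD !rmorphM !lftK.
  rewrite -(dual_red rker _ _ iE Ehh); set A := s _ + _; split=> EA.
    by rewrite -[A](addrK (s d * y * (h * h))); apply: idealB => //; apply: (EM).
  by apply: ED => //; apply: EM.
split=> [DF a b Cab | H G CG].
  have := (Eprod _ (s b) a erefl).1 (DF _ Cab); by rewrite lftK.
have [y [EG CE]] := dual_split rker G iC Chh.
by apply/(Eprod _ _ _ EG)/H/CE.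
Qed.

Let f0 : f != 0. Proof. by case: C_data => _ []. Qed.
Let Ef : f = g * e. Proof. by case: C_data => _ []. Qed.
Let ge0 : g != 0 /\ e != 0.
Proof. by apply/andP; rewrite -negb_or -mulf_eq0 -Ef f0. Qed.
Let gE b : dual C 0 b <-> divides g b. Proof. by case: C_data. Qed.
Let fE a : image C a <-> exists2 z, Z z & a = z * f. Proof. by case: C_data. Qed.

(* With q = z0 * f, an element (v * z0 * e, d) of D and an element (v * f, y) of C
   correspond to each other by d * g = t * v - z0 * y, where (q, t) is s0. *)
Theorem linked_triple_data :
  exists2 z0, Z z0 /\ q = z0 * f & triple_data D Z (z0 * e) z0 e.
Proof.
have [E0 ED EM] := iE; have [g0 e0] := ge0.
have [t [_ [s0E tE]]] := complete_intersection_dual h_neq0 rker s0.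
have Cqt : dual C q t by apply/s0E.
have [z0 Zz0 qE] : exists2 z, Z z & q = z * f by apply/fE; exists t.
have [[hZ satZ pair] [_ _ [df hf]] _ _] := C_data; have [iZ _] := hZ.
have [a1 [a2 [Za1 Za2 cop]]] := pair.
have z00 : z0 != 0 by apply: contraNneq q_neq0 => z; rewrite qE z mul0r.
have zE z : Z z -> exists y, dual C (z * f) y by move=> Zz; apply/fE; exists z.
have ef0 : e * f != 0 by rewrite mulf_neq0.
have cross a b a' b' : dual C (a * f) b -> dual C (a' * f) b' -> divides g (a' * b - a * b').
  move=> Ca Cb; apply/gE; have := dualB iC (dualM a' iC Ca) (dualM a iC Cb).
  by congr (dual C _ _); ring.
exists z0 => //; split=> //.
- split=> //; first exact: mulf_neq0.
  have [|dw [hw _]] := homog_divides (g := z0 * e) q_neq0 (red_homog r s0_homog).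
    by exists g; rewrite qE Ef; ring.
  by exists dw.
- move=> d; rewrite linked_dual; split=> [H | [d' ->] a b Cab]; last first.
    have [z Zz Ea] : exists2 z, Z z & a = z * f by apply/fE; exists b.
    by apply/tE; exists 0, (d' * z); split; rewrite ?qE ?Ea; ring.
  have z0d z : Z z -> divides z0 (z * d).
    move=> /zE[y Cy]; have /tE[x [y' [/esym/eqP + Ey]]] := H _ _ Cy.
    rewrite mul0r mulf_eq0 (negbTE q_neq0) /= => /eqP x0.
    exists y'; apply: (mulIf f0); transitivity (0 * y + d * (z * f)); first by ring.
    by rewrite Ey x0 qE; ring.
  by apply: (cop z0 d); apply: z0d.
move=> c; split=> [[d /linked_dual H] | [v Zv ->]].
  (* Multiplication by the element (0, g) of C gives c g = q v, and q = z0 e g. *)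
  have [v Ec] : exists v, c = v * (z0 * e).
    have /tE[x [v [/esym/eqP + Ev]]] : dual E (c * 0) (c * g + d * 0).
      by apply: H; apply/gE/divides_refl.
    rewrite mulr0 mulf_eq0 (negbTE q_neq0) /= => /eqP x0.
    exists v; apply: (mulIf g0); transitivity (c * g + d * 0); first by ring.
    by rewrite Ev x0 qE Ef; ring.
  exists v => //.
  have star z y : Z z -> dual C (z * f) y -> exists y',
      z0 * v * y + z * (d * g) = z0 * g * y' + t * v * z.
    move=> Zz /H /tE[x [y' [Ex Ey]]]; exists y'; apply: (mulIf e0).
    have xE : x = v * e * z by apply: (mulfI q_neq0); rewrite -Ex Ec qE; ring.
    transitivity (c * y + d * (z * f)); first by rewrite Ec Ef; ring.
    by rewrite Ey xE qE Ef; ring.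
  (* Modulo z0 the relation [star] says that every z in Z annihilates t v - d g; a coprime pair in Z
     cancels z. *)
  have [yv Eyv] : divides z0 (t * v - d * g).
    have dz z : Z z -> divides z0 (z * (t * v - d * g)).
      move=> Zz; have [y Cy] := zE z Zz; have [y' Ey'] := star z y Zz Cy.
      exists (v * y - g * y').
      transitivity (z0 * g * y' + t * v * z - z * (d * g) - z0 * g * y'); first by ring.
      by rewrite -Ey'; ring.
    by apply: (cop z0); apply: dz.
  (* It remains to lift v f to C. By [star], C contains z times the pair (v f, yv) for every z in Z,
     and unmixedness of C removes z. *)
  suff Cv : dual C (v * f) yv.
    have [|z' Zz' /(mulIf f0) ->] // := (fE (v * f)).1; by exists yv.
  have [_ _ uC _] := C_plane.
  rewrite /dual; apply: (uC Z hZ pair).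
    apply/(dual_h rker _ iC Chh)/gE; rewrite rmorphD [r (h * _)]rmorphM (red_h rker) mul0r addr0 lftK Ef.
    by apply/divides_mull/divides_mulr/divides_refl.
  move=> z Zz; have [y Cy] := zE z Zz; have [y' Ey'] := star z y Zz Cy.
  have Cz : dual C (z * (v * f)) (z * yv).
    have Cg : dual C 0 (g * y') by apply/gE/divides_mulr/divides_refl.
    have := dualB iC (dualM v iC Cy) Cg; rewrite subr0.
    congr (dual C _ _); first by ring.
    apply: (mulfI z00); transitivity (z0 * v * y + z * (d * g) - z0 * g * y' - z * (d * g)).
      by ring.
    rewrite Ey'; transitivity (z * (t * v - d * g)); first by ring.
    by rewrite Eyv; ring.
  by move: Cz; rewrite /dual !rmorphM; congr (C _); ring.
(* Conversely, comparing the lift (v f, yv) with (q, t) in C shows that g divides v t - z0 yv; the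
   quotient is the required d. *)
have [yv Cv] := zE v Zv.
have [d Ed] : divides g (v * t - z0 * yv).
  by apply: cross Cv; rewrite -qE.
exists d; apply/linked_dual => a b Cab.
have [z Zz Ea] : exists2 z, Z z & a = z * f by apply/fE; exists b.
have [y' Ey'] : divides g (v * b - z * yv) by apply: cross Cv; rewrite -Ea.
apply/tE; exists (v * e * z), y'; split; first by rewrite Ea qE; ring.
transitivity (e * (z0 * (v * b - z * yv) + z * (z0 * yv + d * g))).
  by rewrite Ea Ef; ring.
by rewrite Ey' -Ed qE Ef; ring.
Qed.

(** The support of D is the plane curve z0 e = 0: as z0 lies in Z, z0 (z0 e) is a first component of
    D, so z0 e vanishes at every point of D. If z0 e is a unit, D is the unit ideal. *)
Lemma linked_curve_or_empty : curve_or_empty D /\ subscheme D (double_plane h).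
Proof.
have [D0 DD DM] := linked_ideal; have [hD Dhh uD _] := linked_generically_plane.
split; last by move=> _ [y ->]; rewrite expr2; apply: DM.
have [z0 [Zz0 _] [[_ _ pair] [w0 _ [dw hw]] z0E wE]] := linked_triple_data.
have [w1 | w1] := pselect (divides (z0 * e) 1); last first.
  left; apply: (curve_criterion rker hD Dhh uD hw w0 w1).
    move=> F DF; have [|z _ ->] := (wE (r F)).1; last exact/divides_mull/divides_refl.
    by rewrite (imageE rker linked_ideal Dhh); exists F.
  move=> p [_ [ip _ pm] _] ph Dp.
  have [||//] := pm (s z0) (s (z0 * e)).
    rewrite -rmorphM; have [b Db] : image D (z0 * (z0 * e)) by apply/wE; exists z0.
    rewrite -[s _](addrK (h * s b)); apply: idealB => //; first exact: Dp.
    by rewrite mulrC; case: ip => _ _; apply.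
  by move=> pz0; rewrite [z0 * e]mulrC rmorphM; case: ip => _ _; apply.
right; have [u Eu] := w1; have D1 : D 1; last first.
  by apply/seteqP; split=> // F _; rewrite -[F]mulr1; apply: DM.
(* Here z0 is a unit lying in Z, so Z contains u and 1 = u z0 e is a first component; its second
   component b can be removed because z0 divides it. *)
have [b Db] : image D 1.
  apply/wE; exists u => //; have [[[[_ _ ZM] _] _ _] _ _ _] := C_data.
  have -> : u = u * u * e * z0 by rewrite -[LHS]mulr1 Eu; ring.
  exact: ZM.
have D0b : dual D 0 b by apply/z0E/unit_divides; exists (u * e); rewrite Eu; ring.
have := dualB linked_ideal Db D0b; rewrite subr0 subrr /dual !rmorph0 rmorph1 mulr0 addr0.
by [].
Qed.

End LinkedTriple.

(** * Linked schemes, divisor differences and liaison classes *)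

Section Liaison.
Variables (k : closedFieldType) (h : {mpoly k[4]}) (r : retraction k 4 3).
Hypothesis h_linear : h \is 1.-homog.
Hypothesis h_neq0 : h != 0.
Hypothesis rker : forall F, r F = 0 <-> divides h F.
Notation s := (lft r).
Notation ext := (extension r).
Notation "<( g )>" := [set x | divides g x].
Notation generically_plane := (generically_plane h r).
Notation triple_data := (triple_data h r).
Implicit Types C D S : set {mpoly k[4]}.

Lemma meets_properly_neq0 F : meets_properly h (principal F) -> r F != 0.
Proof.
move=> [_ ndim]; apply: contra_notN ndim => /eqP rF0.
rewrite (cap_plane_principal rker) rF0; apply: (dim_ge_plane (r := r)) => G [y].
by rewrite mulr0.
Qed.

(** This allows the residual to be computed as a colon of the ideal generated by h^2 and F
    itself. *)
Lemma saturated_complete_intersection F : r F != 0 ->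
  scheme_cap (double_plane h) (principal F) = ideal_sum (double_plane h) (principal F).
Proof.
move=> rF0; apply: (unmixed_saturated (h := h) (r := r)).
- exact: complete_intersection_ideal.
- exact: complete_intersection_unmixed.
- exact: complete_intersection_hh.
Qed.

Lemma surface_equation C S : surface S -> subscheme C S -> meets_properly h S ->
  exists F d, [/\ S = principal F, F \is d.-homog, C F & r F != 0].
Proof.
move=> [d [F [_ hF _ ->]]] sub /meets_properly_neq0 rF0; exists F, d; split=> //.
by apply: sub; exists 1; rewrite mul1r.
Qed.

Lemma linked_data C Z f g e F d : generically_plane C -> triple_data C Z f g e ->
  F \is d.-homog -> C F -> r F != 0 ->
  let D := residual (scheme_cap (double_plane h) (principal F)) C in
  [/\ generically_plane D, curve_or_empty D, subscheme D (double_plane h)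
    & exists z, [/\ Z z, r F = z * f & triple_data D Z (z * e) z e]].
Proof.
move=> gC TC hF CF rF0; rewrite /residual saturated_complete_intersection //.
have gD := linked_generically_plane h_linear h_neq0 rker hF rF0 gC.
have [cD sD] := linked_curve_or_empty h_linear h_neq0 rker hF rF0 gC TC CF.
have [z [Zz qE] TD] := linked_triple_data h_neq0 rker hF rF0 gC TC CF.
by split=> //; exists z.
Qed.

Lemma divisor_difference_mul x y d : x * y != 0 -> x * y \is d.-homog ->
  divisor_difference (plane h) (ext <(x * y)>) (ext <(x)>) (ext <(y)>).
Proof.
move=> xy0 hxy; move: (xy0); rewrite mulf_eq0 negb_or => /andP[x0 y0].
have eff u e : u != 0 -> u \is e.-homog -> effective_divisor (plane h) (ext <(u)>).
  by move=> u0 hu; apply/(effective_divisorP rker); exists e, u.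
have effd u : u != 0 -> divides u (x * y) -> effective_divisor (plane h) (ext <(u)>).
  by move=> u0 /(homog_divides xy0 hxy)[e [hu _]]; apply: (eff u e).
split.
- exact: eff hxy.
- by apply: effd => //; exists y; rewrite mulrC.
- by apply: effd => //; exists x.
rewrite (add_divisor_principal rker (principal_ideal x) (principal_saturated x) y0).
congr (ext _); apply/seteqP; split=> z.
  by move=> [c ->]; exists (c * x); [exists c | rewrite mulrA].
by move=> [_ [c ->] ->]; exists c; rewrite mulrA.
Qed.

Lemma divisor_difference_factor Q R x : x != 0 ->
  divisor_difference (plane h) Q (ext <(x)>) R ->
  exists y d, [/\ y != 0, y \is d.-homog, R = ext <(y)> & Q = ext <(x * y)>].
Proof.
move=> x0 [_ _ /(effective_divisorP rker) [d [y [hy y0 ->]]] ->].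
exists y, d; split=> //.
rewrite (add_divisor_principal rker (principal_ideal x) (principal_saturated x) y0).
congr (ext _); apply/seteqP; split=> z.
  by move=> [_ [c ->] ->]; exists c; rewrite mulrA.
by move=> [c ->]; exists (c * x); [exists c | rewrite mulrA].
Qed.

(* Z and the divisor P - Y, read off any triple of X. *)
Definition liaison_invariant C (W : set {mpoly k[3]} * set {mpoly k[4]}) :=
  exists f g e, triple_data C W.1 f g e /\ W.2 = ext <(e)>.

Lemma liaison_invariant_unique C W W' : liaison_invariant C W -> liaison_invariant C W' -> W = W'.
Proof.
case: W W' => [Z R] [Z' R'] [f [g [e [/= T ->]]]] [f' [g' [e' [/= T' ->]]]].
by have [-> _ _ ->] := triple_data_unique T T'.
Qed.

(** Along a direct link only the passage from C to D is computed. The reverse follows from existence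
    of an invariant for C and its uniqueness for D, without appeal to the symmetry of linkage. *)
Lemma liaison_invariantE C D W : liaison h C D ->
  liaison_invariant C W <-> liaison_invariant D W.
Proof.
elim=> [{}C {}D [[cC sC] [cD sD] [S [surf sub prop ED]]] | // | X Y _ IH | X Y V _ IH1 _ IH2].
- have gC := curve_or_empty_generically_plane h_linear rker cC sC.
  have fwd W' : liaison_invariant C W' -> liaison_invariant D W'.
    move=> [f [g [e [T EW]]]].
    have [F [d [ES hF CF rF0]]] := surface_equation surf sub prop.
    have [_ _ _ [z [_ _ TD]]] := linked_data gC T hF CF rF0.
    by exists (z * e), z, e; rewrite ED ES.
  split; first exact: fwd.
  move=> DW; have [Z [f [g [e T]]]] := triple_data_exists h_linear rker gC.
  have CI : liaison_invariant C (Z, ext <(e)>) by exists f, g, e.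
  by rewrite (liaison_invariant_unique DW (fwd _ CI)).
- by rewrite IH.
- by rewrite IH1.
Qed.

End Liaison.

Theorem proposition7p1 (k : closedFieldType) (h : {mpoly k[4]})
    (h_linear : h \is 1.-homog) (h_neq0 : h != 0) :
  (forall C Z Y P S Q D : set {mpoly k[4]},
     curve C -> subscheme C (double_plane h) -> has_triple h C Z Y P ->
     surface S -> subscheme C S -> meets_properly h S ->
     Q = scheme_cap (plane h) S ->
     D = residual (scheme_cap (double_plane h) S) C ->
     [/\ curve_or_empty D, subscheme D (double_plane h) &
       exists QP QY : set {mpoly k[4]},
         [/\ divisor_difference (plane h) Q P QP,
             divisor_difference (plane h) Q Y QY,
             has_triple h D Z QP QY
           & subscheme Z QP]])
  /\
  (forall C Z Y P Q QP : set {mpoly k[4]},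
     curve C -> subscheme C (double_plane h) -> has_triple h C Z Y P ->
     curve Q -> subscheme Q (plane h) -> subscheme P Q ->
     divisor_difference (plane h) Q P QP -> subscheme Z QP ->
     exists S D QY : set {mpoly k[4]},
       [/\ linked_by h S C D,
           curve_or_empty D /\ subscheme D (double_plane h),
           divisor_difference (plane h) Q Y QY
         & has_triple h D Z QP QY])
  /\
  (forall C Z Y P C' Z' Y' P' : set {mpoly k[4]},
     curve_or_empty C -> subscheme C (double_plane h) ->
     curve_or_empty C' -> subscheme C' (double_plane h) ->
     has_triple h C Z Y P -> has_triple h C' Z' Y' P' ->
     liaison h C C' ->
     Z = Z' /\
     exists PY : set {mpoly k[4]},
       divisor_difference (plane h) P Y PY /\
       divisor_difference (plane h) P' Y' PY).
Proof.
have [r rker] := linear_retraction h_linear h_neq0; split; [|split].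
- move=> C Z Y P S Q D cC sC tC surf sub prop EQ ED.
  have gC := curve_or_empty_generically_plane h_linear rker (or_introl cC) sC.
  have [Zb [f [g [e [T EZ EY EP]]]]] := triple_data_of_triple h_linear rker gC tC.
  have [F [d [ES hF CF rF0]]] := surface_equation rker surf sub prop.
  have := linked_data h_linear h_neq0 rker gC T hF CF rF0; rewrite -ES -ED => -[gD cD sD].
  move=> [z0 [Zz0 qE TD]]; have hq := red_homog r hF.
  have [[hZ _ _] [f0 Ef _] _ _] := T.
  have {}EQ : Q = extension r [set x | divides (r F) x].
    by rewrite EQ ES (cap_plane_principal rker).
  (* The two factorizations q = z0 f = g (z0 e) of the equation of Q give those of Q - P and Q -
     Y. *)
  split=> //; exists (extension r [set x | divides z0 x]), (extension r [set x | divides (z0 * e) x]).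
  split.
  + rewrite EQ EP qE mulrC.
    by apply: (divisor_difference_mul rker (d := d)); rewrite mulrC -qE.
  + have qE' : r F = g * (z0 * e) by rewrite qE Ef; ring.
    by rewrite EQ EY qE'; apply: (divisor_difference_mul rker (d := d)); rewrite -qE'.
  + by rewrite EZ; exact: (triple_of_triple_data h_linear rker gD TD).
  by rewrite EZ => G [c Ec]; rewrite /extension /= Ec; case: hZ => -[_ _ ZM] _; apply: ZM.
- move=> C Z Y P Q QP cC sC tC cQ sQ PQ dQP ZQP.
  have gC := curve_or_empty_generically_plane h_linear rker (or_introl cC) sC.
  have [Zb [f [g [e [T EZ EY EP]]]]] := triple_data_of_triple h_linear rker gC tC.
  have [_ [f0 Ef [df hf]] _ fE] := T; have [hC Chh _ _] := gC; have [iC piC] := hC.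
  have effQ : effective_divisor (plane h) Q by case: dQP.
  rewrite EP in dQP; have [z0 [d0 [z00 hz0 EQP EQ]]] := divisor_difference_factor rker f0 dQP.
  (* The inclusion of Z in Q - P means exactly that the equation of Q - P lies in the ideal of Z. *)
  have Zz0 : Zb z0.
    have : Z (lft r z0) by apply: ZQP; rewrite EQP /extension /= lftK; apply: divides_refl.
    by rewrite EZ /extension /= lftK.
  have hq : f * z0 \is (df + d0).-homog by apply: dhomogM.
  have q0 : f * z0 != 0 by rewrite mulf_neq0.
  (* Any lift of z0 f to C may be replaced by its component of the degree of z0 f, which is a lift
     as well. *)
  have [F [CF rF hF]] : exists F, [/\ C F, r F = f * z0 & F \is (df + d0).-homog].
    have : image h r C (z0 * f) by apply/fE; exists z0.
    rewrite (imageE rker iC Chh) => -[F [CF rF]].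
    exists (pihomog mdeg (df + d0) F); split; [exact: piC | | exact: pihomogP].
    by rewrite -(graded_pihomog (@red_homog _ _ _ r)) rF mulrC pihomog_dE.
  pose S := principal F; pose D := residual (scheme_cap (double_plane h) S) C.
  have EQ' : scheme_cap (plane h) S = Q by rewrite (cap_plane_principal rker) rF EQ.
  have surf : surface S.
    exists (df + d0)%N, F; split=> //; last first.
      by apply: contraNneq q0 => F0; rewrite -rF F0 rmorph0.
    (* In degree zero the equation of Q would be a unit and the curve Q would have no points. *)
    rewrite lt0n; apply/eqP => e0; move: hq; rewrite e0 => hq.
    have [_ [[[p [pP _]] _] _] _] := cQ.
    have [[_ [_ p1 _] _] Qp] := pP 0%N isT.
    apply: p1; apply: Qp; rewrite EQ /extension /= rmorph1.
    exact: homog0_unit.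
  have sub : subscheme C S by move=> _ [y ->]; case: iC => _ _; apply.
  have prop : meets_properly h S by rewrite /meets_properly EQ'; case: cQ => _ [].
  have rF0 : r F != 0 by rewrite rF.
  have [gD cD sD [z [Zz qE TD]]] := linked_data h_linear h_neq0 rker gC T hF CF rF0.
  have zE : z = z0 by apply: (mulIf f0); rewrite -qE rF mulrC.
  rewrite zE in TD; exists S, D, (extension r [set x | divides (z0 * e) x]); split=> //.
    have fz0 : f * z0 = g * (z0 * e) by rewrite Ef; ring.
    by rewrite EQ EY fz0; apply: (divisor_difference_mul rker (d := df + d0)); rewrite -fz0.
  by rewrite EZ EQP; exact: (triple_of_triple_data h_linear rker gD TD).
move=> C Z Y P C' Z' Y' P' cC sC cC' sC' tC tC' CC'.
have gC := curve_or_empty_generically_plane h_linear rker cC sC.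
have gC' := curve_or_empty_generically_plane h_linear rker cC' sC'.
have [Zb [f [g [e [T EZ EY EP]]]]] := triple_data_of_triple h_linear rker gC tC.
have [Zb' [f' [g' [e' [T' EZ' EY' EP']]]]] := triple_data_of_triple h_linear rker gC' tC'.
have I1 : liaison_invariant h r C (Zb, extension r [set x | divides e x]) by exists f, g, e.
have I2 : liaison_invariant h r C' (Zb', extension r [set x | divides e' x]) by exists f', g', e'.
have [EZb Ee] := liaison_invariant_unique
  ((liaison_invariantE h_linear h_neq0 rker _ CC').1 I1) I2.
have diff X W f1 g1 e1 : triple_data h r X W f1 g1 e1 -> divisor_difference (plane h)
    (extension r [set x | divides f1 x]) (extension r [set x | divides g1 x])
    (extension r [set x | divides e1 x]).
  move=> [_ [f10 E1 [d hf]] _ _]; rewrite E1 in f10 hf *.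
  exact: (divisor_difference_mul rker f10 hf).
split; first by rewrite EZ EZ' EZb.
exists (extension r [set x | divides e x]); split; first by rewrite EP EY; apply: diff T.
by rewrite EP' EY' Ee; apply: diff T'.
Qed.
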